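(* Let $X$ be a Polish space with Borel probability measure $\mu$, and let $G$ be a $\mu$-hyperfinite bipartite Borel graph on $X$. Then $\chi'_\mu(G)\leq \Delta(G)+1$.
   Context: A Borel graph on a Polish space $X$ is a graph with vertex set $X$ whose edge set is a Borel subset of $X^2$ (symmetric and irreflexive). Bipartite means having no odd cycles. $\Delta(G)$ is the maximum degree of $G$. The Borel edge chromatic number $\chi'_B(G)$ is the least cardinal $\kappa$ such that $G$ admits a Borel proper edge coloring (adjacent edges get distinct colors) with $\kappa$ colors. A set $C\subseteq X$ is $G$-invariant if it is a union of connected components of $G$. The $\mu$-measurable edge chromatic number $\chi'_\mu(G)$ is the minimum of $\chi'_B(G\upharpoonright C)$ over all $\mu$-conull $G$-invariant Borel sets $C$. A Borel graph is component finite if all its connected components are finite; it is hyperfinite if it is a countable increasing union of component finite Borel graphs. $G$ is $\mu$-hyperfinite if there is a $\mu$-conull $G$-invariant Borel set $C$ such that $G\upharpoonright C$ is hyperfinite. *)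

(* Defs.v *)
From HB Require Import structures.
From mathcomp Require Import all_boot all_order all_algebra.
From mathcomp Require Import all_classical all_reals all_analysis.

Set Implicit Arguments.
Unset Strict Implicit.
Unset Printing Implicit Defensive.

Local Open Scope classical_set_scope.
Local Open Scope card_scope.

Definition complete_metric (R : realType) (M : metricType R) : Prop :=
  forall F : set_system M, ProperFilter F -> cauchy F -> exists l : M, F --> l.

(* Polishness is a property of the topology alone: no metric is fixed. *)
Definition polish (R : realType) (T : topologicalType) : Prop :=
  (exists2 D : set T, countable D & dense D) /\
  exists (M : metricType R) (f : T -> M) (g : M -> T),
    [/\ complete_metric M, cancel f g, cancel g f, continuous f
      & continuous g].

Definition borel (T : topologicalType) : set (set T) := <<s @open T >>.

Section Graphs.
Variable X : topologicalType.
Implicit Types (G H : set (X * X)) (A C : set X).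

(* A graph with vertex set [X] is its set of ordered adjacent pairs. *)
Definition borel_graph G : Prop :=
  [/\ borel G, forall x y, G (x, y) -> G (y, x) & forall x, ~ G (x, x)].

Definition edge G : rel X := fun x y => (x, y) \in G.

Definition bipartite G : Prop :=
  forall s : seq X, ucycle (edge G) s -> ~~ odd (size s).

Definition component G (x : X) : set X :=
  [set y | exists2 p : seq X, path (edge G) x p & y = last x p].

Definition invariant G C : Prop :=
  exists A, C = \bigcup_(x in A) component G x.

(* The restriction of [G] to [C] is kept on the vertex set [X]. The vertices
   outside [C] become isolated, which changes neither edge colorings nor the
   finiteness of components. *)
Definition restrict G C : set (X * X) := G `&` (C `*` C).

Definition component_finite G : Prop :=
  forall x, finite_set (component G x).

Definition hyperfinite G : Prop :=
  exists F : nat -> set (X * X),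
    [/\ forall n, borel_graph (F n), forall n, component_finite (F n),
        forall n, F n `<=` F n.+1 & G = \bigcup_n F n].

Definition neighbors G (x : X) : set X := [set y | G (x, y)].

(* Cardinals are represented by types, up to equinumerosity. The maximum degree
   is the supremum of the degrees, and it may be infinite. *)
Definition is_max_degree G (D : Type) : Prop :=
  (forall x, neighbors G x #<= [set: D]) /\
  (forall E : Type, (forall x, neighbors G x #<= [set: E]) ->
     [set: D] #<= [set: E]).

(* [c] matters only on [G]; its values there are the colors, taken from [S].
   Symmetry on [G] makes it a function of the unordered edge. *)
Definition borel_proper_edge_coloring G (Y : topologicalType) (S : set Y)
    (c : X * X -> Y) : Prop :=
  [/\ forall e, G e -> S (c e),
      forall x y, G (x, y) -> c (x, y) = c (y, x),
      forall x y z, G (x, y) -> G (x, z) -> y <> z -> c (x, y) <> c (x, z)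
    & forall B : set Y, borel B -> borel (G `&` c @^-1` B)].

(* The colors form a standard Borel space of cardinality [K], given as a Borel
   subset of a Polish space. It may be empty when [G] has no edge. *)
Definition borel_edge_colorable (R : realType) G (K : Type) : Prop :=
  exists (Y : topologicalType) (S : set Y) (c : X * X -> Y),
    [/\ polish R Y, borel S, S #= [set: K]
      & borel_proper_edge_coloring G S c].

Definition is_borel_edge_chromatic_number (R : realType) G (K : Type) : Prop :=
  borel_edge_colorable R G K /\
  (forall L : Type, borel_edge_colorable R G L -> [set: K] #<= [set: L]).

End Graphs.

Section Measured.
Variables (R : realType) (X : ptopologicalType).
Variable mu : probability (g_sigma_algebraType (@open X)) R.
Implicit Types (G : set (X * X)) (C : set X).

Definition conull_invariant_borel G C : Prop :=
  [/\ borel C, mu (~` C) = 0%E & invariant G C].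

Definition mu_hyperfinite G : Prop :=
  exists2 C, conull_invariant_borel G C & hyperfinite (restrict G C).

Definition is_mu_edge_chromatic_number G (K : Type) : Prop :=
  (exists2 C, conull_invariant_borel G C
     & is_borel_edge_chromatic_number R (restrict G C) K) /\
  (forall (C : set X) (L : Type), conull_invariant_borel G C ->
     is_borel_edge_chromatic_number R (restrict G C) L ->
     [set: K] #<= [set: L]).

End Measured.

(* Main.v *)
(* Vertices are split by a Borel set [A] whose [r]-neighborhood and whose
   complement both induce component-finite graphs, for [r] as large as wanted:
   write the graph as an increasing union of component-finite graphs [F n], pass
   to a sparse subsequence, and let [A] consist of the vertices on the boundary of
   an [F n]-component that are far from the boundary of the next one. By
   Borel-Cantelli almost every vertex has all its large components bounded by [A];
   the exceptional set is a tail event, hence invariant, so quasi-invariance of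
   the measure is not needed.
   On a component-finite graph a coloring that exists can be chosen in a Borel way.
   First color the neighborhood of [A] with [d] colors (Koenig), then color the
   complement of [A] compatibly. At each step of the second coloring one matching
   is peeled off: a color class of the first coloring is kept near [A], a color
   class of a Koenig coloring is kept away from [A], and the edges where the two
   collide get one extra color. The steps take place at pairwise distant layers
   around [A], so a single extra color serves for all of them.
   Borelness of the sets involved rests on the Lusin-Souslin theorem and on the
   case of finite sections of the Lusin-Novikov theorem. *)
Require Import Defs.
From mathcomp Require Import all_boot all_order all_algebra.
From mathcomp Require Import all_classical all_reals all_analysis.
From mathcomp Require Import ring zify.

Set Implicit Arguments.
Unset Strict Implicit.
Unset Printing Implicit Defensive.

Import Order.TTheory GRing.Theory Num.Theory.
Import numFieldNormedType.Exports.
Local Open Scope classical_set_scope.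
Local Open Scope card_scope.
(* MathComp-Analysis has another [restrict]. *)
Local Notation restrict := Defs.restrict.

(** * Borel sets and Souslin schemes *)

(** The obstacle is that [d] colors come only from choices that are not Borel: a side is assigned to
    a vertex by choosing a root and a path in its component, and both Koenig's theorem and the
    extension argument depend on the sides. Their colorings are therefore mere witnesses of
    existence, and [borel_coloring_choice] replaces them, one finite component at a time. This
    forces a cover by two component-finite pieces, the second being colored with the first coloring
    prescribed on an overlap so that the two can be glued. The radius [(3 * d).+2] has two layers
    for this overlap and three for each of the [d] matchings. Descriptive set theory serves to
    enumerate neighbors by countably many Borel maps [phi k]; a quantifier over neighbors then
    becomes a quantifier over [nat]. If no finite number of colors suffices on any conull invariant
    set, then [Delta] is infinite, and a coloring by [nat] built directly from the maps [phi k]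
    attains the minimum. *)

Section BorelSets.
Context {T : topologicalType}.
Implicit Types A B : set T.

Lemma borel_open A : open A -> borel A.
Proof. exact: sub_sigma_algebra. Qed.

Lemma borelC A : borel A -> borel (~` A).
Proof.
by move=> bA; rewrite -setTD; have [_ + _] := smallest_sigma_algebra setT (@open T); apply.
Qed.

Lemma borel_bigcup (A : nat -> set T) :
  (forall n, borel (A n)) -> borel (\bigcup_n A n).
Proof. by have [_ _] := smallest_sigma_algebra setT (@open T); apply. Qed.

Lemma borel_ind (P : set T -> Prop) :
  (forall A, open A -> P A) -> (forall A, P A -> P (~` A)) ->
  (forall A : nat -> set T, (forall n, P (A n)) -> P (\bigcup_n A n)) ->
  forall A, borel A -> P A.
Proof.
move=> Po PC PU A; apply: (@smallest_sub _ _ (@open T) P) => //.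
split=> [|B /PC|F FP]; [by apply: Po; exact: open0|by rewrite setTD|exact: PU].
Qed.

Lemma borel_closed A : closed A -> borel A.
Proof. by move=> cA; rewrite -(setCK A); apply: borelC; apply: borel_open; exact: closed_openC. Qed.

Lemma borelT : borel [set: T].
Proof. apply: borel_open; exact: openT. Qed.

Lemma borel0 : borel (@set0 T).
Proof. apply: borel_open; exact: open0. Qed.

Lemma borel_exists (I : countType) (P : I -> T -> Prop) :
  (forall i, borel [set x | P i x]) -> borel [set x | exists i, P i x].
Proof.
move=> bP.
pose A n := if unpickle n is Some i then [set x | P i x] else set0.
have -> : [set x | exists i, P i x] = \bigcup_n A n.
  apply/seteqP; split=> x /=.
    by move=> [i Pix]; exists (pickle i) => //; rewrite /A pickleK.
  by move=> [n _]; rewrite /A; case: (unpickle n) => [i|] //= Pi; exists i.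
by apply: borel_bigcup => n; rewrite /A; case: (unpickle n) => [i|]; [exact: bP|exact: borel0].
Qed.

Lemma borel_not (P : T -> Prop) : borel [set x | P x] -> borel [set x | ~ P x].
Proof. exact: borelC. Qed.

Lemma borel_forall (I : countType) (P : I -> T -> Prop) :
  (forall i, borel [set x | P i x]) -> borel [set x | forall i, P i x].
Proof.
move=> bP; have -> : [set x | forall i, P i x] = [set x | ~ exists i, ~ P i x].
  apply/seteqP; split=> x /= Px; first by move=> [i]; apply.
  by move=> i; apply: contrapT => nP; apply: Px; exists i.
by apply: borel_not; apply: borel_exists => i; apply: borel_not; exact: bP.
Qed.

Lemma borel_and (P Q : T -> Prop) :
  borel [set x | P x] -> borel [set x | Q x] -> borel [set x | P x /\ Q x].
Proof.
move=> bP bQ; have -> : [set x | P x /\ Q x] = [set x | forall b : bool, if b then P x else Q x].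
  by apply/seteqP; split=> x /= => [[Px Qx] []|PQ] //; split; [exact: (PQ true)|exact: (PQ false)].
by apply: borel_forall => -[].
Qed.

Lemma borel_imp (P Q : T -> Prop) :
  borel [set x | P x] -> borel [set x | Q x] -> borel [set x | P x -> Q x].
Proof.
move=> bP bQ; have -> : [set x | P x -> Q x] = [set x | ~ (P x /\ ~ Q x)].
  apply/seteqP; split=> x /= PQ; first by move=> [/PQ].
  by move=> Px; apply: contrapT => nQ; apply: PQ.
by apply: borel_not; apply: borel_and => //; exact: borel_not.
Qed.

Lemma borel_or (P Q : T -> Prop) :
  borel [set x | P x] -> borel [set x | Q x] -> borel [set x | P x \/ Q x].
Proof.
move=> bP bQ; have -> : [set x | P x \/ Q x] = [set x | exists b : bool, if b then P x else Q x].
  by apply/seteqP; split=> x /= => [[Px|Qx]|[[]]]; [exists true|exists false|left|right].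
by apply: borel_exists => -[].
Qed.

Lemma borel_cst (P : Prop) : borel [set _ : T | P].
Proof.
have [p|np] := pselect P.
  by rewrite (_ : [set _ | _] = setT); [exact: borelT|apply/seteqP; split].
by rewrite (_ : [set _ | _] = set0); [exact: borel0|apply/seteqP; split].
Qed.

End BorelSets.

Definition borel_map (S T : topologicalType) (f : S -> T) :=
  forall B, borel B -> borel (f @^-1` B).

Lemma borel_map_open (S T : topologicalType) (f : S -> T) :
  (forall U, open U -> borel (f @^-1` U)) -> borel_map f.
Proof.
move=> fo; apply: borel_ind => // [A|A bA]; first by rewrite preimage_setC; exact: borelC.
by rewrite preimage_bigcup; exact: borel_bigcup.
Qed.

Lemma continuous_borel (S T : topologicalType) (f : S -> T) :
  continuous f -> borel_map f.
Proof.
by move=> /continuousP cf; apply: borel_map_open => U oU; apply: borel_open; exact: cf.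
Qed.

Lemma borel_map_comp (S T U : topologicalType) (g : T -> U) (f : S -> T) :
  borel_map g -> borel_map f -> borel_map (g \o f).
Proof. by move=> bg bf B /bg /bf. Qed.

(** An infinite branch of the tree of finite sequences, allowed to pause: lengths need only be
    unbounded. The words that [sub] extracts from a branch do pause. *)
Definition chain (b : nat -> seq nat) :=
  (forall n, prefix (b n) (b n.+1)) /\ (forall m, exists n, (m <= size (b n))%N).

Lemma chain_prefix b m n : chain b -> (m <= n)%N -> prefix (b m) (b n).
Proof.
move=> [pb _]; elim: n => [|n IH]; first by rewrite leqn0 => /eqP->; exact: prefix_refl.
rewrite leq_eqVlt => /orP[/eqP->|/IH mn]; first exact: prefix_refl.
exact: prefix_trans mn (pb n).
Qed.

(** In a scheme for a union the first letter names a piece; without it, what remains is a branch of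
    the scheme for that piece. *)
Lemma chain_behead b : chain b -> exists n N,
  (forall m, b (N + m)%N = n :: behead (b (N + m)%N)) /\
  chain (fun m => behead (b (N + m)%N)).
Proof.
move=> cb; have [N] := cb.2 1%N; case E : (b N) => [//|n s] _; exists n, N.
have bN m : b (N + m)%N = n :: behead (b (N + m)%N).
  have /prefixP[t] : prefix (b N) (b (N + m)%N) by apply: chain_prefix => //; exact: leq_addr.
  by rewrite E => ->.
split=> //; split=> [m|m].
  by have := cb.1 (N + m)%N; rewrite addnS bN -addnS [b (_ + m.+1)%N]bN /= eqxx.
have [k hk] := cb.2 m.+1; exists k.
have := size_prefix (chain_prefix cb (leq_addl N k)).
by move/(leq_trans hk); rewrite bN.
Qed.

Section Scheme.
Context {T : topologicalType}.
Implicit Types (A : set T) (d : bool).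

(* A Souslin scheme for [A] whose branches converge to points of [A]. The flag
   [d] selects Lusin schemes: Borel nodes and disjoint siblings. *)
Definition is_scheme d A (P : seq nat -> set T) :=
  [/\ P [::] = A, forall s, P s = \bigcup_j P (rcons s j),
      d -> (forall s, borel (P s)) /\
           forall s i j x, P (rcons s i) x -> P (rcons s j) x -> i = j
    & forall b, chain b -> (forall n, P (b n) !=set0) ->
        exists2 x, A x & forall U, open U -> U x -> exists n, P (b n) `<=` U].

Definition scheme d A := exists P, is_scheme d A P.

Lemma scheme_weak d A : scheme d A -> scheme false A.
Proof. by move=> [P [? ? ? ?]]; exists P; split. Qed.

Lemma is_scheme_prefix d A P s t : is_scheme d A P -> prefix s t -> P t `<=` P s.
Proof.
move=> [_ PE _ _] /prefixP[u ->]; elim/last_ind: u => [|u j IH]; first by rewrite cats0.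
by rewrite -rcons_cat => x Px; apply: IH; rewrite PE; exists j.
Qed.

(* Only the root must contain the limits of branches, so an F_sigma set can be
   cut into pieces that are not closed. *)
Lemma scheme_Fsigma d (E : nat -> set T) : (forall n, closed (E n)) ->
  scheme d [set: T] -> scheme d (\bigcup_n E n).
Proof.
move=> cE [P [P0 PE Pd Pl]].
pose D n := [set x | E n x /\ forall i, (i < n)%N -> ~ E i x].
pose Q s := if s is n :: s' then D n `&` P s' else \bigcup_n E n.
have bE n : borel (E n) by apply: borel_closed; exact: cE.
exists Q; split=> //.
- case=> [|n s] /=; last by rewrite PE setI_bigcupr.
  apply/seteqP; split=> x /=.
    move=> [n _ Enx].
    have ex : exists n, `[< E n x >] by exists n; exact/asboolP.
    case: (ex_minnP ex) => k /asboolP Ek kmin; exists k => //; split; last by rewrite P0.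
    split=> // i ik /asboolP Ei; have := kmin _ Ei; by rewrite leqNgt ik.
  by move=> [n _ [[En _] _]]; exists n.
- move=> dt; have [Pb Pdisj] := Pd dt; split=> [[|n s]|[|n s] i j x] /=.
  + exact: borel_bigcup.
  + apply: borel_and; last exact: Pb.
    apply: borel_and; first exact: bE.
    apply: borel_forall => i; apply: borel_imp; first exact: borel_cst.
    apply: borel_not; exact: bE.
  + move=> [[Ei nEi] _] [[Ej nEj] _]; apply/eqP; rewrite eqn_leq.
    by apply/andP; split; rewrite leqNgt; apply/negP => ij; [apply: nEi Ej|apply: nEj Ei].
  + by move=> [_ Pi] [_ Pj]; exact: Pdisj Pi Pj.
- move=> b cb; have [n [N [bN cb']]] := chain_behead cb => bne.
  have [|x _ xl] := Pl _ cb'.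
    by move=> m; have [y] := bne (N + m)%N; rewrite bN => -[_ Py]; exists y.
  have lim U : open U -> U x -> exists m, Q (b (N + m)%N) `<=` U.
    move=> oU Ux; have [m sub] := xl U oU Ux; exists m.
    by rewrite bN => y [_]; exact: sub.
  exists x; last by move=> U oU Ux; have [m] := lim U oU Ux; exists (N + m)%N.
  exists n => //; apply: contrapT => nE.
  (* A limit outside the closed set [E n] would have a whole node in the open complement, but the
     nodes of this branch are nonempty parts of [E n]. *)
  have [m sub] := lim (~` E n) (closed_openC (cE n)) nE.
  have [y Qy] := bne (N + m)%N; have := sub y Qy; apply.
  by move: Qy; rewrite bN => -[[]].
Qed.

Lemma scheme_bigcup d (A : nat -> set T) : (forall n, scheme d (A n)) ->
  (d -> forall i j x, A i x -> A j x -> i = j) -> scheme d (\bigcup_n A n).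
Proof.
move=> /choice[P hP] Ad.
pose Q s := if s is n :: s' then P n s' else \bigcup_n A n.
have P0 n : P n [::] = A n by have [] := hP n.
exists Q; split=> //.
- case=> [|n s] /=; last by have [_ ->] := hP n.
  by apply: eq_bigcupr => n _; rewrite P0.
- move=> dt; split=> [[|n s]|[|n s] i j x] /=.
  + by apply: borel_bigcup => n; rewrite -P0; have [_ _ /(_ dt)[]] := hP n.
  + by have [_ _ /(_ dt)[]] := hP n.
  + by rewrite !P0; exact: Ad.
  + by have [_ _ /(_ dt)[_ disj] _] := hP n; exact: disj.
- move=> b cb; have [n [N [bN cb']]] := chain_behead cb => bne.
  have [_ _ _ /(_ _ cb')] := hP n; case.
    by move=> m; have [y] := bne (N + m)%N; rewrite bN => Py; exists y.
  move=> x Ax xl; exists x; first by exists n.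
  by move=> U oU Ux; have [m sub] := xl U oU Ux; exists (N + m)%N; rewrite bN.
Qed.

End Scheme.

Section Interleave.
Variable h : nat -> nat.

(** One word codes a family of words: its letter at position [t] goes to the word of index [h t]. A
    branch thus runs through several schemes at once, advancing in one of them at a time. *)
Definition sub i (s : seq nat) := mask [seq h t == i | t <- iota 0 (size s)] s.

Lemma sub_rcons i s m :
  sub i (rcons s m) = if h (size s) == i then rcons (sub i s) m else sub i s.
Proof.
rewrite /sub size_rcons -addn1 iotaD map_cat /= cats1 mask_rcons ?size_map ?size_iota//.
by rewrite add0n; case: ifP => _; rewrite ?cats1 ?cats0.
Qed.

Lemma sub_prefix i s t : prefix s t -> prefix (sub i s) (sub i t).
Proof.
move=> /prefixP[u ->]; elim/last_ind: u => [|u j IH]; first by rewrite cats0 prefix_refl.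
rewrite -rcons_cat sub_rcons; case: ifP => // _.
exact: prefix_trans IH (prefix_rcons _ _).
Qed.

Lemma sub_chain i b : (forall m, exists2 t, (m <= t)%N & h t = i) ->
  chain b -> chain (sub i \o b).
Proof.
move=> hi cb; split=> [n|m]; first by apply: sub_prefix; exact: (cb.1 n).
have [K hK] : exists K, forall s, (K <= size s)%N -> (m <= size (sub i s))%N.
  elim: m => [|m [K hK]]; first by exists 0%N.
  have [t Kt ht] := hi K; exists t.+1 => s ts.
  have /size_prefix : prefix (sub i (rcons (take t s) (nth 0%N s t))) (sub i s).
    apply: sub_prefix; rewrite -take_nth//; exact: prefix_take.
  apply: leq_trans; rewrite sub_rcons size_takel ?(ltnW ts)// ht eqxx size_rcons ltnS.
  by apply: hK; rewrite size_takel // ltnW.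
have [n hn] := cb.2 K; exists n; exact: hK.
Qed.

End Interleave.

(** The 2-adic valuation of [t.+1] takes each value infinitely often, so it is a fair schedule for
    countably many schemes. The witness is [2 ^ i] times an odd number, minus one. *)
Lemma logn2_often i m : exists2 t, (m <= t)%N & logn 2 t.+1 = i.
Proof.
have pos : (0 < 2 ^ i * (2 * m + 1))%N by rewrite muln_gt0 expn_gt0 /= addn1.
exists (2 ^ i * (2 * m + 1)).-1.
  rewrite -ltnS prednK // (@leq_trans (2 * m + 1))//; last by rewrite leq_pmull ?expn_gt0.
  by rewrite addn1 ltnS leq_pmull.
rewrite prednK// lognM ?expn_gt0 ?addn1// pfactorK// lognE /= dvdn2 /=.
by rewrite oddM /= addn0.
Qed.

Section SchemeInter.
Context {T : topologicalType}.
Hypothesis hT : hausdorff_space T.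
Implicit Types A B : set T.

(** A node is an intersection of nodes, one from each scheme, refined in turn. The limits of the
    coordinate branches coincide: two distinct ones would have disjoint neighborhoods, both
    containing a common nonempty node. *)
Lemma scheme_bigcap d (A : nat -> set T) :
  (forall n, scheme d (A n)) -> scheme d (\bigcap_n A n).
Proof.
move=> /choice[P hP].
pose h t := logn 2 t.+1.
pose Q s := \bigcap_i P i (sub h i s).
have P0 n : P n [::] = A n by have [] := hP n.
have Pr n s : P n s = \bigcup_j P n (rcons s j) by have [] := hP n.
exists Q; split.
- by apply: eq_bigcapr => n _; rewrite P0.
- move=> s; apply/seteqP; split=> x.
    move=> Qx; have := Qx (h (size s)) I; rewrite Pr => -[j _ Pj].
    exists j => // i _; rewrite sub_rcons; case: eqP => [<-//|_]; exact: Qx.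
  move=> [j _ Qx] i _; have := Qx i I; rewrite sub_rcons; case: ifP => // _ Px.
  by rewrite Pr; exists j.
- move=> dt; split=> [s|s i j x].
    have -> : Q s = [set x | forall i, P i (sub h i s) x].
      by apply/seteqP; split=> x /= => [Qx i|Qx i _]; apply: Qx.
    by apply: borel_forall => i; have [_ _ /(_ dt)[+ _] _] := hP i; exact.
  move=> /(_ (h (size s)) I) + /(_ (h (size s)) I).
  rewrite !sub_rcons eqxx; have [_ _ /(_ dt)[_ disj] _] := hP (h (size s)).
  exact: disj.
- move=> b cb bne.
  have /choice[x hx] i : exists x, A i x /\ forall U, open U -> U x ->
      exists n, P i (sub h i (b n)) `<=` U.
    have [_ _ _ /(_ (sub h i \o b))] := hP i; case.
    + by apply: sub_chain => //; exact: logn2_often.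
    + by move=> n; have [y /(_ i I)] := bne n; exists y.
    + by move=> x Ax xl; exists x.
  have xE i : x i = x 0%N.
    apply/eqP; apply: contrapT => /negP nx.
    move: hT; rewrite open_hausdorff => /(_ _ _ nx)[[U V]/= [/set_mem Ux /set_mem Vx] [oU oV /eqP UV]].
    have [n hn] := (hx i).2 U oU Ux; have [m hm] := (hx 0%N).2 V oV Vx.
    have [y Qy] := bne (maxn n m).
    suff : (U `&` V) y by rewrite UV.
    split; [apply: hn; have := Qy i I|apply: hm; have := Qy 0%N I].
      by apply: (is_scheme_prefix (hP i)); apply: sub_prefix; apply: chain_prefix => //; exact: leq_maxl.
    by apply: (is_scheme_prefix (hP 0%N)); apply: sub_prefix; apply: chain_prefix => //; exact: leq_maxr.
  exists (x 0%N).
    by move=> i _; rewrite -(xE i); exact: (hx i).1.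
  move=> U oU Ux; have [n hn] := (hx 0%N).2 U oU Ux.
  by exists n => y /(_ 0%N I); exact: hn.
Qed.

Lemma schemeI d A B : scheme d A -> scheme d B -> scheme d (A `&` B : set T).
Proof.
move=> sA sB.
rewrite (_ : A `&` B = \bigcap_n (if n is 0%N then A else B)).
  by apply: scheme_bigcap => -[].
apply/seteqP; split=> x => [[Ax Bx] []//|AB]; split; [exact: (AB 0%N)|exact: (AB 1%N)].
Qed.

(** Schemes alone are not visibly stable under complement. Carrying the complement along gives an
    invariant that passes through the generation of Borel sets. *)
Definition bischeme d A := scheme d A /\ scheme d (~` A).

Lemma bischemeC d A : bischeme d A -> bischeme d (~` A).
Proof. by move=> [sA sC]; split; rewrite ?setCK. Qed.

Lemma bischeme_bigcup d (A : nat -> set T) :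
  (forall n, bischeme d (A n)) -> bischeme d (\bigcup_n A n).
Proof.
move=> sA; split; last by rewrite setC_bigcup; apply: scheme_bigcap => n; exact: (sA n).2.
(* Disjoint pieces; the indices [i >= n] are padded with [A n], so that the intersection runs over
   [nat] as [scheme_bigcap] requires. *)
pose B n := A n `&` \bigcap_i (if (i < n)%N then ~` A i else A n).
have -> : \bigcup_n A n = \bigcup_n B n.
  apply/seteqP; split=> x /=; last by move=> [n _ [An _]]; exists n.
  move=> [n _ Anx].
  have ex : exists n, `[< A n x >] by exists n; exact/asboolP.
  case: (ex_minnP ex) => k /asboolP Ak kmin; exists k => //; split=> // i _.
  case: ifP => // ik /asboolP Ai; have := kmin _ Ai; by rewrite leqNgt ik.
apply: scheme_bigcup => [n|_ i j x].
  apply: schemeI; first exact: (sA n).1.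
  by apply: scheme_bigcap => i; case: ifP => _; [exact: (sA i).2|exact: (sA n).1].
move=> [Ai nAi] [Aj nAj]; apply/eqP; rewrite eqn_leq.
apply/andP; split; rewrite leqNgt; apply/negP => ij.
  by have := nAi j I; rewrite ij; apply.
by have := nAj i I; rewrite ij; apply.
Qed.

Lemma borel_scheme d A :
  (forall U : set T, open U -> bischeme d U) -> borel A -> scheme d A.
Proof.
move=> ho bA; suff [] : bischeme d A by [].
move: A bA; apply: borel_ind => // [A|A]; [exact: bischemeC|exact: bischeme_bigcup].
Qed.

End SchemeInter.

(** * Novikov separation and the Lusin-Souslin theorem *)

Lemma borel_map_fst (X Y : topologicalType) : borel_map (@fst X Y).
Proof. by apply: continuous_borel => x; exact: cvg_fst. Qed.

Lemma borel_map_snd (X Y : topologicalType) : borel_map (@snd X Y).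
Proof. by apply: continuous_borel => x; exact: cvg_snd. Qed.

Lemma open_prodP (X Y : topologicalType) (U : set (X * Y)) x y :
  open U -> U (x, y) -> exists A B, [/\ open A, open B, A x, B y & A `*` B `<=` U].
Proof.
move=> oU Uxy; have : nbhs (x, y) U by exact: open_nbhs_nbhs.
move=> [[A B]] /= [nA nB] sub; exists A^°, B^°; split=> //; try exact: open_interior.
by move=> z [/interior_subset Az /interior_subset Bz]; exact: sub.
Qed.

Lemma hausdorff_prod (X Y : topologicalType) :
  hausdorff_space X -> hausdorff_space Y -> hausdorff_space (X * Y)%type.
Proof.
move=> hX hY [x y] [x' y'] cl; congr pair.
  apply: hX => A B nA nB.
  have [||[z t]/= [Az Bz]] := cl (fst @^-1` A) (fst @^-1` B); last by exists z.
    exact: (@cvg_fst _ _ (nbhs x) (nbhs y)).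
  exact: (@cvg_fst _ _ (nbhs x') (nbhs y')).
apply: hY => A B nA nB.
have [||[z t]/= [Az Bz]] := cl (snd @^-1` A) (snd @^-1` B); last by exists t.
  exact: (@cvg_snd _ _ (nbhs x) (nbhs y)).
exact: (@cvg_snd _ _ (nbhs x') (nbhs y')).
Qed.

Lemma schemeX (X Y : topologicalType) d (A : set X) (B : set Y) :
  scheme d A -> scheme d B -> scheme d (A `*` B).
Proof.
move=> [P hP] [Q hQ].
have [P0 PE Pd Pl] := hP; have [Q0 QE Qd Ql] := hQ.
(* Even positions refine the first factor, odd positions the second. *)
pose h t : nat := odd t.
pose W s := P (sub h 0 s) `*` Q (sub h 1 s).
have hoft i : (i < 2)%N -> forall m, exists2 t, (m <= t)%N & h t = i.
  move=> i2 m; exists (m.*2 + i)%N; first by rewrite -addnn -addnA leq_addr.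
  by rewrite /h oddD odd_double; case: i i2 => [|[]].
exists W; split.
- by rewrite /W /sub /= P0 Q0.
- move=> s; apply/seteqP; split=> [[x y]|[x y] [j _]].
    move=> [/= Px Qy].
    case E : (odd (size s)).
      move: Qy; rewrite QE => -[j _ Qj]; exists j => //.
      by split; rewrite /= sub_rcons /h E.
    move: Px; rewrite PE => -[j _ Pj]; exists j => //.
    by split; rewrite /= sub_rcons /h E.
  rewrite /W !sub_rcons /h; case: (odd _) => /= -[/= Px Qy]; split=> //=.
    by rewrite QE; exists j.
  by rewrite PE; exists j.
- move=> dt; have [Pb Pdis] := Pd dt; have [Qb Qdis] := Qd dt.
  split=> [s|s i j [x y]].
    apply: borel_and; first exact: (borel_map_fst (Pb _)).
    exact: (borel_map_snd (Qb _)).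
  rewrite /W !sub_rcons /h; case: (odd _) => /= -[/= Px Qy] [/= Px' Qy'].
    exact: Qdis Qy Qy'.
  exact: Pdis Px Px'.
- move=> b cb bne.
  have [|n|x Ax xl] := Pl (sub h 0 \o b); first by apply: sub_chain => //; exact: hoft.
    by have [[x y] [/= Px _]] := bne n; exists x.
  have [|n|y By yl] := Ql (sub h 1 \o b); first by apply: sub_chain => //; exact: hoft.
    by have [[z y] [/= _ Py]] := bne n; exists y.
  exists (x, y); first by [].
  move=> U oU Uxy; have [A' [B' [oA oB A'x B'y sU]]] := open_prodP oU Uxy.
  have [n hn] := xl A' oA A'x; have [m hm] := yl B' oB B'y.
  exists (maxn n m) => -[z t] [/= Pz Qt]; apply: sU; split => /=.
    apply: hn; apply: (is_scheme_prefix hP) Pz; apply: sub_prefix; apply: chain_prefix => //.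
    exact: leq_maxl.
  apply: hm; apply: (is_scheme_prefix hQ) Qt; apply: sub_prefix; apply: chain_prefix => //.
  exact: leq_maxr.
Qed.

(** Projection may destroy Borelness and disjointness of the nodes, hence the flag [false], but
    convergence of branches survives: the projection is analytic. *)
Lemma scheme_fst (X Y : topologicalType) d (A : set (X * Y)) :
  scheme d A -> scheme false (fst @` A).
Proof.
move=> [P [P0 PE _ Pl]]; exists (fun s => fst @` P s); split => //.
- by rewrite P0.
- by move=> s; rewrite PE image_bigcup.
- move=> b cb bne; have [|z Az zl] := Pl b cb.
    by move=> n; have [_ [z Pz _]] := bne n; exists z.
  exists z.1; first by exists z.
  move=> U oU Uz; have [||n hn] := zl (fst @^-1` U) => //.
    by apply: open_comp => // t _; exact: cvg_fst.
  by exists n => _ [t Pt <-]; exact: hn.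
Qed.

Section Novikov.
Context {T : topologicalType}.
Hypothesis hT : hausdorff_space T.
Implicit Types A B : nat -> set T.

Definition borel_separated A :=
  exists B, (forall i, borel (B i) /\ A i `<=` B i) /\ \bigcap_i B i = set0.

Definition upd (S : Type) (A : nat -> S) (k : nat) (a : S) : nat -> S :=
  fun i => if i == k then a else A i.

(** Unite the separating sets at the coordinate [k] that is split and intersect them elsewhere: a
    point of all the new sets picks one [j] at [k], and then lies in every set of the [j]-th
    separation. *)
Lemma borel_separated_bigcup A k (F : nat -> set T) : A k = \bigcup_j F j ->
  (forall j, borel_separated (upd A k (F j))) -> borel_separated A.
Proof.
move=> Ak /choice[B hB].
have bB j i : borel (B j i) by have [/(_ i)[]] := hB j.
have AB j i : upd A k (F j) i `<=` B j i by have [/(_ i)[]] := hB j.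
exists (fun i => if i == k then \bigcup_j B j k else \bigcap_j B j i); split.
  move=> i; case: eqP => [->|/eqP ik].
    split; first exact: borel_bigcup.
    by rewrite Ak => x [j _ Fx]; exists j => //; apply: AB; rewrite /upd eqxx.
  split; last by move=> x Ax j _; apply: AB; rewrite /upd (negbTE ik).
  have -> : \bigcap_j B j i = [set x | forall j, B j i x].
    by apply/seteqP; split=> x /= => [Qx j|Qx j _]; apply: Qx.
  by apply: borel_forall => j; exact: bB.
apply/seteqP; split=> // x Bx; have := Bx k I; rewrite eqxx => -[j _ Bk].
have [_ <-] := hB j; move=> i _; have [->//|ik] := eqVneq i k.
by have := Bx i I; rewrite (negbTE ik); apply.
Qed.

(** If separation fails, each coordinate can be refined in turn so that it keeps failing, which
    yields a branch in every scheme. Equal limits would be a common point of the [A i]; two distinct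
    limits have disjoint open neighborhoods, which separate some stage. *)
Lemma novikov_separation A : (forall i, scheme false (A i)) ->
  \bigcap_i A i = set0 -> borel_separated A.
Proof.
move=> /choice[P hP] A0; apply: contrapT => nsep.
pose h t := logn 2 t.+1.
have PE i s : P i s = \bigcup_j P i (rcons s j) by have [_ + _ _] := hP i.
pose good (s : nat -> seq nat) := ~ borel_separated (fun i => P i (s i)).
have /choice[next nextP] : forall p : nat * (nat -> seq nat), exists j,
    good p.2 -> good (upd p.2 (h p.1) (rcons (p.2 (h p.1)) j)).
  move=> [t s] /=; have [gs|] := pselect (good s); last by exists 0%N.
  apply: contrapT => nj; apply: gs.
  apply: (borel_separated_bigcup (k := h t) (PE _ _)) => j.
  apply: contrapT => nsj; apply: nj; exists j => _ sj; apply: nsj.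
  apply: eq_ind sj _ _; apply: funext => i /=; rewrite /upd.
  by case: eqP => // ->.
pose st := fix st t := if t is t'.+1 then
  upd (st t') (h t') (rcons (st t' (h t')) (next (t', st t'))) else fun _ => [::].
have gst t : good (st t).
  elim: t => [|t IH] /=; last exact: (nextP (t, st t)).
  move=> s0; apply: nsep; apply: eq_ind s0 _ _; apply: funext => i.
  by have [] := hP i.
have stE t i : st t.+1 i = if i == h t then rcons (st t i) (next (t, st t)) else st t i.
  by rewrite /= /upd; case: eqP => // ->.
have ch i : chain (st^~ i).
  split=> [t|m]; first by rewrite stE; case: ifP => _; [exact: prefix_rcons|exact: prefix_refl].
  elim: m => [|m [t mt]]; first by exists 0%N.
  have [u tu hu] := logn2_often i t.
  exists u.+1; rewrite stE -hu eqxx size_rcons ltnS hu.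
  apply: leq_trans mt _; move: tu; elim: u {hu} => [|u IH]; first by rewrite leqn0 => /eqP->.
  rewrite leq_eqVlt => /orP[/eqP->//|/IH/leq_trans]; apply.
  by rewrite stE; case: ifP => // _; rewrite size_rcons.
(* An empty node would separate its stage, with [set0] at its coordinate and [setT] elsewhere. *)
have ne i t : P i (st t i) !=set0.
  apply/set0P/eqP => P0; apply: (gst t); exists (upd (fun _ => setT) i set0); split.
    move=> j; rewrite /upd; case: eqP => [->|_]; last by split=> //; exact: borelT.
    by rewrite P0; split=> //; exact: borel0.
  by apply/seteqP; split=> // x /(_ i I); rewrite /upd eqxx.
have /choice[x hx] i : exists x, A i x /\ forall U, open U -> U x ->
      exists n, P i (st n i) `<=` U.
  have [_ _ _ /(_ _ (ch i) (ne i))] := hP i.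
  by move=> [x Ax xl]; exists x.
have [|] := pselect (forall i, x i = x 0%N).
  move=> xE; suff : set0 (x 0%N) by [].
  by rewrite -A0 => i _; rewrite -(xE i); exact: (hx i).1.
move=> /existsNP[i /eqP nx].
have i0 : i != 0%N by apply: contraNneq nx => ->.
move: hT; rewrite open_hausdorff => /(_ _ _ nx)[[U V]/= [/set_mem Ux /set_mem Vx] [oU oV /eqP UV]].
have [n hn] := (hx i).2 U oU Ux; have [m hm] := (hx 0%N).2 V oV Vx.
apply: (gst (maxn n m)); exists (upd (upd (fun _ => setT) i U) 0 V); split.
  move=> j; rewrite /upd; case: eqP => [->|_].
    split; first exact: borel_open.
    apply: subset_trans hm; apply: (is_scheme_prefix (hP 0%N)).
    by apply: (chain_prefix (ch 0%N)); exact: leq_maxr.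
  case: eqP => [->|_]; last by split=> //; exact: borelT.
  split; first exact: borel_open.
  apply: subset_trans hn; apply: (is_scheme_prefix (hP i)).
  by apply: (chain_prefix (ch i)); exact: leq_maxl.
rewrite -UV; apply/seteqP; split=> y.
  by move=> By; split; [have := By i I|have := By 0%N I]; rewrite /upd ?eqxx ?(negbTE i0).
by rewrite UV.
Qed.

(** Novikov's theorem for the sequence [A, B, B, ...]: all separating sets but the first contain
    [B]. *)
Lemma lusin_separation (A B : set T) : scheme false A -> scheme false B ->
  A `&` B = set0 -> exists2 E, borel E & A `<=` E /\ B `<=` ~` E.
Proof.
move=> sA sB AB.
have [||F [hF F0]] := @novikov_separation (fun i => if i is 0%N then A else B); first by case.
  rewrite -AB; apply/seteqP; split=> [x ABx|x [Ax Bx] []//].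
  by split; [exact: (ABx 0%N)|exact: (ABx 1%N)].
exists (F 0%N); first exact: (hF 0%N).1.
split; first exact: (hF 0%N).2.
move=> x Bx F0x; suff : set0 x by [].
by rewrite -F0 => -[//|i] _; exact: (hF i.+1).2.
Qed.

End Novikov.

Definition functional_set (X Y : Type) (B : set (X * Y)) :=
  forall x y y', B (x, y) -> B (x, y') -> y = y'.

(** As [B] is functional, sibling nodes have disjoint analytic projections, which Borel sets
    separate. A point is in the projection of [B] exactly when each level has a sequence of nested
    enclosing cells containing it: disjointness aligns these sequences into one branch, and the
    limit of the branch lies above the point. *)
Lemma lusin_souslin (X Y : topologicalType) (B : set (X * Y)) :
  hausdorff_space X -> (forall A : set (X * Y), borel A -> scheme true A) ->
  borel B -> functional_set B -> borel (fst @` B).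
Proof.
move=> hX hS bB fB; have [P hP] := hS B bB.
have [P0 PE /(_ isT)[Pb Pd] Pl] := hP.
pose Q s := fst @` P s.
have PB s : P s `<=` B by rewrite -P0; apply: (is_scheme_prefix hP); exact: prefix0s.
have sQ s : scheme false (Q s) by apply: (@scheme_fst _ _ true); exact: hS.
have Qd s i j : i <> j -> Q (rcons s i) `&` Q (rcons s j) = set0.
  move=> ij; apply/seteqP; split=> // x [[[x1 y] /= Pi xE] [[x2 y'] /= Pj xE']]; apply: ij.
  subst x1 x2; have yy : y = y' by apply: fB (PB _ _ Pi) (PB _ _ Pj).
  by subst y'; apply: Pd Pi Pj.
have /choice[E hE] : forall p : seq nat * nat * nat, exists E, p.1.2 <> p.2 ->
    [/\ borel E, Q (rcons p.1.1 p.1.2) `<=` E & Q (rcons p.1.1 p.2) `<=` ~` E].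
  move=> [[s i] j] /=; have [->|/eqP ij] := eqVneq i j; first by exists set0.
  by have [E bE [E1 E2]] := lusin_separation hX (sQ _) (sQ _) (Qd s i j ij); exists E.
(* The closure keeps the point adherent to the projections along its branch; this is what identifies
   it with the projection of the limit. *)
pose F s i := [set x | closure (Q (rcons s i)) x /\
  forall j, i <> j -> E (s, i, j) x /\ ~ E (s, j, i) x].
have bF s i : borel (F s i).
  apply: borel_and; first by apply: borel_closed; exact: closed_closure.
  apply: borel_forall => j; have [->|/eqP ij] := eqVneq i j.
    by rewrite (_ : [set _ | _] = setT); [exact: borelT|apply/seteqP; split].
  apply: borel_imp; first exact: borel_cst.
  apply: borel_and; first by have [] := hE (s, i, j) ij.
  by apply: borel_not; have [] := hE (s, j, i) (nesym ij).
have QF s i : Q (rcons s i) `<=` F s i.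
  move=> x Qx; split; first exact: subset_closure.
  move=> j ij; split; first by have [_ + _] := hE (s, i, j) ij; exact.
  by have [_ _ +] := hE (s, j, i) (nesym ij); exact.
have Fd s i j x : F s i x -> F s j x -> i = j.
  move=> [_ Fi] [_ Fj]; apply: contrapT => ij.
  by have [] := Fi j ij; have [] := Fj i (nesym ij).
pose G s x := forall k, (k < size s)%N -> F (take k s) (nth 0%N s k) x.
have -> : fst @` B = [set x | forall n, exists s, size s = n /\ G s x].
  apply/seteqP; split=> x /=.
    move=> [[x' y] Bxy /= ?] n; subst x'.
    have [s [sn Ps]] : exists s, size s = n /\ P s (x, y).
      elim: n => [|n [s [<-]]]; first by exists [::]; rewrite P0.
      by rewrite PE => -[j _ Pj]; exists (rcons s j); rewrite size_rcons.
    exists s; split=> // k ks; apply: QF; exists (x, y) => //.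
    by rewrite -take_nth//; apply: (is_scheme_prefix hP) Ps; exact: prefix_take.
  move=> /choice[b hb].
  have tk s s' k : G s x -> G s' x -> (k <= size s)%N -> (k <= size s')%N -> take k s = take k s'.
    move=> Gs Gs'; elim: k => [|k IH] ks ks'; first by rewrite !take0.
    rewrite (take_nth 0%N ks) (take_nth 0%N ks') IH ?(ltnW ks) ?(ltnW ks')//; congr rcons.
    have := Gs k ks; rewrite IH ?(ltnW ks) ?(ltnW ks')// => F1.
    exact: Fd F1 (Gs' k ks').
  have cb : chain b.
    split=> [n|m]; last by exists m; rewrite (hb m).1.
    have tE := tk (b n.+1) (b n) n (hb _).2 (hb _).2.
    rewrite prefixE (hb n).1 tE ?(hb n).1 ?(hb n.+1).1//.
    by rewrite take_oversize ?(hb n).1.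
  have clo n : closure (Q (b n.+1)) x.
    have := (hb n.+1).2 n; rewrite (hb n.+1).1 => /(_ (leqnn _))[].
    by rewrite -take_nth ?(hb n.+1).1// take_oversize ?(hb n.+1).1.
  have sub n : P (b n.+1) `<=` P (b n) by apply: (is_scheme_prefix hP); exact: cb.1.
  have [|[x' y] Bz zl] := Pl b cb.
    move=> n; have [_ [[z Pz _] _]] := clo n setT filterT.
    by exists z; exact: sub.
  exists (x', y) => //=; apply/eqP; apply: contrapT => /negP nx.
  move: hX; rewrite open_hausdorff => /(_ _ _ nx)[[U V]/= [/set_mem Ux /set_mem Vx] [oU oV /eqP UV]].
  have [||n hn] := zl (fst @^-1` U) => //.
    by apply: open_comp => // t _; exact: cvg_fst.
  have [z [[t Pt tz] Vz]] := clo n V (open_nbhs_nbhs (conj oV Vx)).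
  have : (U `&` V) z by split=> //; rewrite -tz; apply: hn; exact: sub.
  by rewrite UV.
apply: borel_forall => n; apply: borel_exists => s.
apply: borel_and; first exact: borel_cst.
apply: borel_forall => k; apply: borel_imp; first exact: borel_cst.
exact: bF.
Qed.

(** * Borel sets with finite sections *)

Definition regular_basis (X : topologicalType) (V : nat -> set X) :=
  (forall n, open (V n)) /\
  forall x U, open U -> U x -> exists n, V n x /\ closure (V n) `<=` U.

Lemma polish_regular_basis (R : realType) (X : ptopologicalType) : polish R X ->
  [/\ hausdorff_space X, exists V : nat -> set X, regular_basis V
    & scheme true [set: X]].
Proof.
move=> [[D /countable_injP[e einj] dD] [M [f [g [cM fgK gfK cf cg]]]]].
pose d n := xget point [set x | D x /\ e x = n].
have dE x : D x -> d (e x) = x.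
  move=> Dx; rewrite /d; case: xgetP => [y _ [Dy eyx]|/(_ x) []//].
  by apply: einj => //; exact/mem_set.
pose W n i := f @^-1` (ball (f (d i)) (n.+1%:R^-1))^°.
have oW n i : open (W n i).
  by apply: open_comp => [x _|]; [exact: cf|exact: open_interior].
have inv_gt0 n : (0 < n.+1%:R^-1 :> R)%R by rewrite invr_gt0.
have WB n i x : W n i x -> ball (f (d i)) n.+1%:R^-1 (f x).
  by move=> /interior_subset.
have covW n x : exists i, W n i x.
  (* With half the radius, a dense point this close to [x] has a full ball that contains a
     neighborhood of [x]. *)
  have h0 : (0 < (n.+1%:R^-1 / 2) :> R)%R by rewrite divr_gt0.
  have [y [By Dy]] : (f @^-1` (ball (f x) (n.+1%:R^-1 / 2))^°) `&` D !=set0.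
    apply: dD; last by apply: open_comp => [z _|]; [exact: cf|exact: open_interior].
    by exists x; rewrite /preimage /=; exact: nbhsx_ballx.
  exists (e y); rewrite /W /= dE//.
  apply/nbhs_ballP; exists (n.+1%:R^-1 / 2)%R => //= z xz.
  rewrite [X in ball _ X](splitr n.+1%:R^-1); apply: ball_triangle xz.
  by apply: ball_sym; exact: interior_subset By.
have gcv x U : open U -> U x -> exists2 r : R, (0 < r)%R & ball (f x) r `<=` g @^-1` U.
  move=> oU Ux; have /nbhs_ballP[r r0 rU] : nbhs (f x) (g @^-1` U).
    by apply: cg; rewrite fgK; exact: open_nbhs_nbhs.
  by exists r.
have smalln (r : R) : (0 < r)%R -> exists n, (n.+1%:R^-1 < r)%R.
  move=> r0; have [n _ hn] := near_infty_natSinv_lt (PosNum r0).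
  by exists n; exact: (hn n (leqnn n)).
have hX : hausdorff_space X.
  rewrite open_hausdorff => x y xy.
  have := @metric_hausdorff _ M; rewrite open_hausdorff => /(_ (f x) (f y)).
  rewrite (can_eq fgK) => /(_ xy)[[U V]/= [/set_mem Ux /set_mem Vx] [oU oV /eqP UV]].
  exists (f @^-1` U, f @^-1` V) => /=; first by split; exact/mem_set.
  split; [by apply: open_comp => // z _; exact: cf|by apply: open_comp => // z _; exact: cf|].
  by rewrite -preimage_setI UV preimage_set0.
split=> //.
  exists (fun n => if unpickle n is Some p then W p.1 p.2 else set0); split.
    by move=> n; case: unpickle => [p|]; [exact: oW|exact: open0].
  move=> x U oU Ux; have [r r0 rU] := gcv x U oU Ux.
  (* Three moves lead from [x] to a closure point [y]: to the center of the ball, to a point [z] of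
     [W] near [y], to [y]. *)
  have [n nr] := smalln (r / 3)%R (divr_gt0 r0 (ltr0n _ 3)).
  have [i Wx] := covW n x; exists (pickle (n, i)); rewrite pickleK /=; split=> // y cy.
  have [|z [Wz Bz]] := cy (f @^-1` ball (f y) n.+1%:R^-1).
    by apply: cf; exact: nbhsx_ballx.
  rewrite -(fgK y); apply: rU.
  have -> : r = (r / 3 + r / 3 + r / 3)%R by field.
  apply: (@ball_triangle _ _ (f z)); last exact: le_ball (ltW nr) _ (ball_sym Bz).
  apply: (@ball_triangle _ _ (f (d i))); last exact: le_ball (ltW nr) _ (WB _ _ _ Wz).
  exact: le_ball (ltW nr) _ (ball_sym (WB _ _ _ Wx)).
(* The first ball of radius [n.+1%:R^-1] that contains the point: each level is a Borel partition,
   and cells shrink along a branch. *)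
pose C n j := [set x | W n j x /\ forall i, (i < j)%N -> ~ W n i x].
pose P s := [set x | forall k, (k < size s)%N -> C k (nth 0%N s k) x].
exists P; split.
- by apply/seteqP; split.
- move=> s; apply/seteqP; split=> x /=.
    move=> Px.
    have ex : exists i, `[< W (size s) i x >].
      by have [i Wi] := covW (size s) x; exists i; exact/asboolP.
    case: (ex_minnP ex) => j /asboolP Wj jmin; exists j => // k.
    rewrite size_rcons ltnS leq_eqVlt nth_rcons => /orP[/eqP->|ks]; last by rewrite ks; exact: Px.
    rewrite ltnn eqxx; split=> // i ij /asboolP Wi; have := jmin _ Wi; by rewrite leqNgt ij.
  move=> [j _ Pj] k ks; have := Pj k; rewrite size_rcons nth_rcons ks; apply.
  exact: leqW.
- move=> _; split=> [s|s i j x].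
    apply: borel_forall => k; apply: borel_imp; first exact: borel_cst.
    apply: borel_and; first by apply: borel_open; exact: oW.
    apply: borel_forall => i; apply: borel_imp; first exact: borel_cst.
    by apply: borel_not; apply: borel_open; exact: oW.
  move=> /(_ (size s)) + /(_ (size s)).
  rewrite !size_rcons !nth_rcons ltnn eqxx => /(_ (leqnn _))[Wi ni] /(_ (leqnn _))[Wj nj].
  apply/eqP; rewrite eqn_leq.
  by apply/andP; split; rewrite leqNgt; apply/negP => ij; [exact: ni Wj|exact: nj Wi].
- move=> b cb bne.
  have mono m n : (m <= n)%N -> P (b n) `<=` P (b m).
    move=> mn x Px k kb; have /prefixP[t tE] := chain_prefix cb mn.
    have := Px k; rewrite tE size_cat nth_cat kb; apply.
    exact: leq_trans kb (leq_addr _ _).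
  (* The filter generated by the nodes of the branch is Cauchy, since level [k] lies in a ball of
     radius [k.+1%:R^-1]. Completeness gives the limit. *)
  pose F : set_system M := [set A | exists n, P (b n) `<=` f @^-1` A].
  have FF : ProperFilter F.
    split; first by move=> [n sub]; have [x /sub] := bne n.
    split; first by exists 0%N.
    - move=> A B [m mA] [n nB]; exists (maxn m n) => x Px; split.
        by apply: mA; apply: mono Px; exact: leq_maxl.
      by apply: nB; apply: mono Px; exact: leq_maxr.
    - by move=> A B AB [m mA]; exists m => x /mA; exact: AB.
  have [l Fl] : exists l : M, F --> l.
    apply: cM; apply: cauchy_exP => r r0.
    have [k kr] := smalln r r0; have [n kn] := cb.2 k.+1.
    exists (f (d (nth 0%N (b n) k))), n => x /(_ k kn)[Wx _].
    exact: le_ball (ltW kr) _ (WB _ _ _ Wx).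
  exists (g l) => // U oU Ugl.
  have [n hn] : F (g @^-1` U) by apply: Fl; apply: cg; exact: open_nbhs_nbhs.
  by exists n => x /hn; rewrite /preimage /= fgK.
Qed.

Section Enumeration.
Context {X : topologicalType} (V : nat -> set X).
Hypotheses (hX : hausdorff_space X) (hV : regular_basis V).
Hypothesis sX : scheme true [set: X].

Lemma borel_prod_snd (A : set X) : borel A -> borel ([set: X] `*` A).
Proof. by move=> bA; rewrite setTX; exact: borel_map_snd. Qed.

(** Regularity makes an open set a countable union of closures of basic sets, so both an open set
    and its complement are F_sigma. *)
Lemma borel_lusin_scheme (A : set X) : borel A -> scheme true A.
Proof.
apply: borel_scheme => // U oU; split; last first.
  rewrite (_ : ~` U = \bigcup_(n : nat) ~` U).
    by apply: scheme_Fsigma => // _; exact: open_closedC.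
  by apply/seteqP; split=> x => [Ux|[]//]; exists 0%N.
rewrite (_ : U = \bigcup_n (if `[< closure (V n) `<=` U >] then closure (V n) else set0)).
  apply: scheme_Fsigma => // n; case: ifP => _; [exact: closed_closure|exact: closed0].
apply/seteqP; split=> x.
  move=> Ux; have [n [Vx cV]] := hV.2 x U oU Ux.
  by exists n => //; rewrite asboolT//; exact: subset_closure.
by move=> [n _]; case: asboolP => // sub; exact: sub.
Qed.

Lemma borel_lusin_scheme2 (A : set (X * X)) : borel A -> scheme true A.
Proof.
have hXX := hausdorff_prod hX hX.
have b1 (U : set X) : borel U -> bischeme true (U `*` [set: X]).
  move=> bU; split; first by apply: schemeX => //; exact: borel_lusin_scheme.
  rewrite setXT preimage_setC -setXT.
  by apply: schemeX => //; apply: borel_lusin_scheme; exact: borelC.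
have b2 (U : set X) : borel U -> bischeme true ([set: X] `*` U).
  move=> bU; split; first by apply: schemeX => //; exact: borel_lusin_scheme.
  rewrite setTX preimage_setC -setTX.
  by apply: schemeX => //; apply: borel_lusin_scheme; exact: borelC.
apply: borel_scheme => // U oU.
pose F n : set (X * X) := if unpickle n is Some p then
  if `[< V p.1 `*` V p.2 `<=` U >] then V p.1 `*` V p.2 else set0 else set0.
have -> : U = \bigcup_n F n.
  apply/seteqP; split=> [[x y] Uxy|z [n _]]; last first.
    by rewrite /F; case: unpickle => [p|] //; case: asboolP => // sub; exact: sub.
  have [A1 [B1 [oA oB Ax By AB]]] := open_prodP oU Uxy.
  have [i [Vi iA]] := hV.2 x A1 oA Ax; have [j [Vj jB]] := hV.2 y B1 oB By.
  exists (pickle (i, j)) => //; rewrite /F pickleK /= asboolT//.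
  move=> z [Vz1 Vz2]; apply: AB; split.
    by apply: iA; exact: subset_closure.
  by apply: jB; exact: subset_closure.
apply: bischeme_bigcup => // n; rewrite /F.
have bi0 : bischeme true (@set0 (X * X)).
  have -> : @set0 (X * X) = [set: X] `*` set0 by apply/seteqP; split=> // z [].
  by apply: b2; exact: borel0.
case: unpickle => [p|] //; case: ifP => // _.
rewrite -[_ `*` _]setCK.
(* A rectangle is reached through unions and complements of cylinders, the operations under which
   [bischeme] is stable. *)
have -> : ~` (V p.1 `*` V p.2) = \bigcup_i
    (if i is 0%N then ~` (V p.1 `*` [set: X]) else ~` ([set: X] `*` V p.2)).
  apply/seteqP; split=> [[x y] /= nV|[x y] [[|i] _] /= nV [Vx Vy]]; last 2 first.
  - by apply: nV.
  - by apply: nV.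
  have [Vx|nVx] := pselect (V p.1 x); last by exists 0%N => // -[].
  by exists 1%N => // -[_ Vy]; apply: nV.
apply: bischemeC; apply: bischeme_bigcup => // -[|i]; apply: bischemeC.
  by apply: b1; apply: borel_open; exact: hV.1.
by apply: b2; apply: borel_open; exact: hV.1.
Qed.

Lemma borel_fst_functional (B : set (X * X)) :
  borel B -> functional_set B -> borel (fst @` B).
Proof. by apply: lusin_souslin => // A; exact: borel_lusin_scheme2. Qed.

(* The points of [B] that [V n] does not isolate in their section form an analytic
   set. As the sections are finite these sets, over all [n], have empty
   intersection, and Novikov separation applies. *)
Lemma borel_finite_sections (B : set (X * X)) :
  borel B -> (forall x, finite_set [set y | B (x, y)]) ->
  exists g : nat -> set (X * X),
    [/\ forall n, borel (g n), forall n, functional_set (g n)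
      & B = \bigcup_n g n].
Proof.
move=> bB fB; have hXX := hausdorff_prod hX hX.
have bV n : borel (V n) by apply: borel_open; exact: hV.1.
have sB (A : set (X * X)) : borel A -> scheme false A.
  by move=> bA; apply: scheme_weak (borel_lusin_scheme2 bA).
pose A n := [set p : X * X | B p /\
  (V n p.2 -> exists y, [/\ y <> p.2, B (p.1, y) & V n y])].
have sA n : scheme false (A n).
  (* A basic set [V a] around the point and a disjoint [V b] around the other point of the section,
     both within [V n], turn the condition into a countable union over pairs of codes. *)
  pose good a b := [/\ V a `&` V b = set0, V a `<=` V n & V b `<=` V n].
  pose F k : set (X * X) := if k is k'.+1 then
    if unpickle k' is Some ab then
      if `[< good ab.1 ab.2 >] then
        (B `&` ([set: X] `*` V ab.1)) `&`
        ((fst @` (B `&` ([set: X] `*` V ab.2))) `*` [set: X])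
      else set0 else set0 else B `&` ([set: X] `*` ~` V n).
  have -> : A n = \bigcup_k F k.
    apply/seteqP; split=> [[x y] [/= Bxy Vn]|[x y] [[|k] _]].
    - have [Vy|nV] := pselect (V n y); last by exists 0%N.
      have [y' [/eqP yy Bxy' Vy']] := Vn Vy.
      move: hX; rewrite open_hausdorff => /(_ _ _ yy)[[U2 U1]/= [/set_mem U2y' /set_mem U1y]
        [oU2 oU1 /eqP UU]].
      have oI (W : set X) : open W -> open (W `&` V n).
        by move=> oW; apply: openI => //; exact: hV.1.
      have [a [Va aU]] := hV.2 y _ (oI _ oU1) (conj U1y Vy).
      have [b [Vb bU]] := hV.2 y' _ (oI _ oU2) (conj U2y' Vy').
      exists (pickle (a, b)).+1 => //; rewrite /F pickleK /= asboolT.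
        by split; split=> //; exists (x, y').
      split; last 2 first.
      + by move=> z /subset_closure /aU[].
      + by move=> z /subset_closure /bU[].
      apply/seteqP; split=> // z [/subset_closure /aU[U1z _] /subset_closure /bU[U2z _]].
      by rewrite -UU.
    - by move=> [/= Bxy [_ nV]]; split.
    - rewrite /F; case: unpickle => [[a b]|] //; case: asboolP => //= -[ab an bn].
      move=> [[Bxy [_ /= Va]] [[[x1 y1] [Bxy1 [_ /= Vb]] /= ?] _]]; subst x1.
      split=> //= _; exists y1; split=> //; last exact: bn.
      by move=> yy; subst y1; suff : (V a `&` V b) y; [rewrite ab|split].
  apply: scheme_bigcup => // -[|k] /=.
    by apply: sB; apply: borel_and => //; apply: borel_prod_snd; exact: borelC.
  case: unpickle => [ab|]; last by apply: sB; exact: borel0.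
  case: ifP => _; last by apply: sB; exact: borel0.
  apply: schemeI => //.
    by apply: sB; apply: borel_and => //; exact: borel_prod_snd.
  apply: schemeX; last exact: scheme_weak sX.
  apply: (@scheme_fst _ _ false); apply: sB.
  by apply: borel_and => //; exact: borel_prod_snd.
have [|E [hE E0]] := novikov_separation hXX sA.
  apply/seteqP; split=> // -[x y] Axy.
  have Bxy : B (x, y) by have [] := Axy 0%N I.
  (* Finiteness of the section: the other points form a closed set, so some [V n] isolates [y] from
     them and [A n] misses [(x, y)]. *)
  pose O := ~` ([set y' | B (x, y')] `\ y).
  have oO : open O.
    apply: closed_openC; move: (hausdorff_accessible hX) => /accessible_finite_set_closed; apply.
    by apply: finite_setD.
  have [|n [Vy cV]] := hV.2 y O oO; first by move=> [_]; apply.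
  have [_ /(_ Vy)[y' [/= yy By' Vy']]] := Axy n I.
  by have := cV _ (subset_closure Vy'); apply.
exists (fun n => B `\` E n); split.
- by move=> n; apply: borel_and => //; apply: borel_not; exact: (hE n).1.
- move=> n x y y' [Bxy nE] [Bxy' nE']; apply: contrapT => yy.
  (* A point of [B] outside [A n] is in [V n] and is alone there in its section; two such points in
     one section would exclude each other. *)
  have Vn z : B (x, z) -> ~ E n (x, z) -> V n z.
    move=> Bz nEz; apply: contrapT => nV; apply: nEz; apply: (hE n).2.
    by split.
  apply: nE; apply: (hE n).2; split=> //= _; exists y'; split=> //; first exact: nesym.
  exact: Vn.
- apply/seteqP; split=> [z Bz|z [n _ []]//].
  apply: contrapT => nz; suff : set0 z by [].
  rewrite -E0 => n _; apply: contrapT => nE; apply: nz; by exists n.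
Qed.

(** Functional Borel pieces extend to total Borel maps because their domains, and the preimages
    under them, are Borel by Lusin-Souslin. *)
Lemma borel_enumeration (G : set (X * X)) (F : nat -> set (X * X)) :
  (forall n, borel (F n)) -> (forall n x, finite_set [set y | F n (x, y)]) ->
  G = \bigcup_n F n ->
  exists phi : nat -> X -> X, (forall k, borel_map (phi k)) /\
    forall x y, G (x, y) -> exists k, y = phi k x.
Proof.
move=> bF fF ->.
have /choice[g hg] n := borel_finite_sections (bF n) (fF n).
have /choice[gf hgf] : forall p : nat * nat, exists f : X -> X, borel_map f /\
    forall x y, g p.1 p.2 (x, y) -> y = f x.
  move=> [n m] /=; have [/(_ m) bg /(_ m) fg _] := hg n.
  (* The default [x] makes [f] the identity outside the domain of the piece. *)
  pose f x := xget x [set y | g n m (x, y)].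
  have fE x y : g n m (x, y) -> y = f x.
    move=> gxy; rewrite /f; case: xgetP => [z _ gxz|/(_ y)//]; exact: fg gxy gxz.
  exists f; split=> // A bA.
  have -> : f @^-1` A = (fst @` (g n m `&` ([set: X] `*` A))) `|`
      (A `&` ~` (fst @` g n m)).
    apply/seteqP; split=> [x /= Afx|x /= [[[x' y] [gxy [_ /= Ay]] /= ?]|[Ax ng]]].
    - have [[[x' y] gxy /= ?]|ng] := pselect ((fst @` g n m) x); last first.
        right; split=> //; move: Afx; rewrite /preimage /= /f; case: xgetP => [y _ gxy|_] //.
        by case: ng; exists (x, y).
      by subst x'; left; exists (x, y) => //; split=> //; split=> //=; rewrite (fE _ _ gxy).
    - by subst x'; rewrite -(fE _ _ gxy).
    - by rewrite /preimage /= /f; case: xgetP => [y _ gxy|_] //; case: ng; exists (x, y).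
  apply: borel_or.
    apply: borel_fst_functional; last by move=> x y y' [gy _] [gy' _]; exact: fg gy gy'.
    by apply: borel_and => //; exact: borel_prod_snd.
  by apply: borel_and => //; apply: borel_not; exact: borel_fst_functional.
exists (fun k => if unpickle k is Some p then gf p else id); split.
  by move=> k; case: unpickle => [p|]; [exact: (hgf p).1|].
move=> x y [n _]; have [_ _ ->] := hg n => -[m _ gxy].
by exists (pickle (n, m)); rewrite pickleK; exact: (hgf (n, m)).2.
Qed.

End Enumeration.

(** * Koenig's theorem and extension of edge colorings *)

Section Combinatorics.
Context {X : topologicalType}.
Implicit Types (H E : set (X * X)) (c f : X * X -> nat) (A : set X).

Definition symmetric_set H := forall x y, H (x, y) -> H (y, x).

Lemma symmetric_restrict H A : symmetric_set H -> symmetric_set (restrict H A).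
Proof. by move=> sH x y [Hxy [/= Ax Ay]]; split; [exact: sH|]. Qed.

Lemma component_refl H x : component H x x.
Proof. by exists [::]. Qed.

Lemma component_edge H x y z : component H x y -> H (y, z) -> component H x z.
Proof.
move=> [p px ->] Hz; exists (rcons p z); last by rewrite last_rcons.
by rewrite rcons_path px; exact/mem_set.
Qed.

Lemma component_ind H x y (P : X -> Prop) : component H x y -> P x ->
  (forall u v, component H x u -> P u -> H (u, v) -> P v) -> P y.
Proof.
move=> [p + ->] Px Pst; elim/last_ind: p => [//|p z IH].
rewrite rcons_path last_rcons => /andP[pp /set_mem Hz].
by apply: Pst (IH pp) Hz; exists p.
Qed.

Lemma component_trans H x y z :
  component H x y -> component H y z -> component H x z.
Proof.
by move=> xy yz; apply: (component_ind yz) => // u v _ xu; exact: component_edge.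
Qed.

Lemma component_sym H x y : symmetric_set H -> component H x y -> component H y x.
move=> sH xy; apply: (component_ind (P := (component H)^~ x) xy) => [|u v _ ux uv].
  exact: component_refl.
exact: component_trans (component_edge (component_refl H v) (sH _ _ uv)) ux.
Qed.

Lemma component_eq H x y : symmetric_set H -> component H x y ->
  component H x = component H y.
Proof.
move=> sH xy; apply/seteqP; split=> z; last exact: component_trans.
by apply: component_trans; exact: component_sym.
Qed.

Lemma component_sub H E x : H `<=` E -> component H x `<=` component E x.
Proof.
move=> HE y xy; apply: (component_ind xy) => [|u v _ xu /HE]; first exact: component_refl.
exact: component_edge.
Qed.

Lemma component_finite_sub H E : H `<=` E -> component_finite E -> component_finite H.
Proof. by move=> HE fE x; apply: sub_finite_set (fE x); exact: component_sub. Qed.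

Definition degree_le d H := forall x (s : seq X),
  uniq s -> (forall y, y \in s -> H (x, y)) -> (size s <= d)%N.

Lemma degree_le_sub d H E : H `<=` E -> degree_le d E -> degree_le d H.
Proof. by move=> HE dE x s us sH; apply: (dE x s us) => y /sH /HE. Qed.

Definition two_sided (side : X -> bool) H := forall x y, H (x, y) -> side x != side y.

Definition coloring N H c :=
  [/\ forall x y, H (x, y) -> (c (x, y) < N)%N,
      forall x y, H (x, y) -> c (x, y) = c (y, x)
    & forall x y z, H (x, y) -> H (x, z) -> c (x, y) = c (x, z) -> y = z].

Lemma coloring_sub N H E c : H `<=` E -> coloring N E c -> coloring N H c.
Proof.
move=> HE [cN cs cp]; split=> [x y /HE|x y /HE|x y z /HE xy /HE]; [exact: cN|exact: cs|exact: cp].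
Qed.

(** If all [d] colors occurred at [u], the other ends of these edges together with [v] would be
    [d.+1] neighbors. *)
Lemma missing_color d H E c u v : degree_le d H -> E `<=` H -> coloring d E c ->
  H (u, v) -> ~ E (u, v) ->
  exists2 a, (a < d)%N & forall y, E (u, y) -> c (u, y) <> a.
Proof.
move=> dH EH [cd _ _] Huv nE; apply: contrapT => nex.
have /choice[f hf] : forall a, exists y, (a < d)%N -> E (u, y) /\ c (u, y) = a.
  move=> a; have [ad|] := boolP (a < d)%N; last by exists u.
  apply: contrapT => ny; apply: nex; exists a => // y Ey cy; apply: ny.
  by exists y.
suff : (size (v :: [seq f a | a <- iota 0 d]) <= d)%N.
  by rewrite /= size_map size_iota ltnn.
apply: (dH u).
  rewrite /= map_inj_in_uniq ?iota_uniq ?andbT.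
    apply/negP => /mapP[a]; rewrite mem_iota /= add0n => ad vE.
    by apply: nE; rewrite vE; exact: (hf a ad).1.
  move=> a b; rewrite !mem_iota /= !add0n => ad bd fab.
  by rewrite -(hf a ad).2 fab (hf b bd).2.
move=> y; rewrite inE => /orP[/eqP->//|/mapP[a]]; rewrite mem_iota /= add0n => ad ->.
exact/EH/(hf a ad).1.
Qed.

Lemma top_color d E c x (s : seq X) : coloring d.+1 E c -> uniq s ->
  (forall y, y \in s -> E (x, y)) -> (d < size s)%N ->
  exists2 y, y \in s & c (x, y) = d.
Proof.
move=> [cd _ cp] us sE ds; apply: contrapT => ny.
have : (size [seq c (x, y) | y <- s] <= size (iota 0 d))%N.
  apply: uniq_leq_size.
    rewrite map_inj_in_uniq // => y z ys zs.
    by apply: cp; exact: sE.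
  move=> _ /mapP[y ys ->]; rewrite mem_iota add0n /=.
  have := cd x y (sE y ys); rewrite ltnS leq_eqVlt => /orP[/eqP cy|//].
  by case: ny; exists y.
by rewrite size_map size_iota leqNgt ds.
Qed.

Inductive kempe (side : X -> bool) E c (a b : nat) (u : X) : X -> Prop :=
| kempe0 : kempe side E c a b u u
| kempeb x y of kempe side E c a b u x & side x & E (x, y) & c (x, y) = b :
    kempe side E c a b u y
| kempea x y of kempe side E c a b u x & ~~ side x & E (x, y) & c (x, y) = a :
    kempe side E c a b u y.

(* The chain leaves the side of [u] along [b] and comes back along [a], so it
   reaches the other side only through [b]-edges and avoids [v]. *)
Lemma kempe_extension d H E c side u v : symmetric_set E -> two_sided side H ->
  degree_le d H -> E `<=` H -> coloring d E c -> H (u, v) -> H (v, u) -> side u ->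
  ~ E (u, v) ->
  exists c', coloring d (E `|` [set (u, v); (v, u)]) c'.
Proof.
move=> sE tH dH EH cE Huv Hvu su nE; have [cd cs cp] := cE.
have nE' : ~ E (v, u) by move=> /sE.
have [a ad am] := missing_color dH EH cE Huv nE.
have [b bd bm] := missing_color dH EH cE Hvu nE'.
pose S := kempe side E c a b u.
have sv : ~~ side v by have := tH _ _ Huv; rewrite su; case: (side v).
(* A vertex of the chain other than [u] was entered along the color that the chain does not use to
   leave it. Hence the chain is closed under both colors, which is [Scl]. *)
have inv x : S x -> if side x then x = u \/ exists y, [/\ S y, E (x, y) & c (x, y) = a]
                    else exists y, [/\ S y, E (x, y) & c (x, y) = b].
  case=> [|z y Sz sz Ezy czy|z y Sz sz Ezy czy]; first by rewrite su; left.
    have := tH _ _ (EH _ Ezy); rewrite sz; case: (side y) => // _.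
    by exists z; split=> //; [exact: sE|rewrite -cs].
  have := tH _ _ (EH _ Ezy); rewrite (negbTE sz); case: (side y) => // _.
  by right; exists z; split=> //; [exact: sE|rewrite -cs].
have Scl x y : S x -> E (x, y) -> c (x, y) = a \/ c (x, y) = b -> S y.
  move=> Sx Exy cxy; have := inv x Sx; case: ifP => sx.
    case: cxy => cxy; last by move=> _; exact: kempeb Sx sx Exy cxy.
    move=> [xu|[z [Sz Exz cxz]]]; first by subst x; case: (am y Exy).
    by rewrite (cp _ _ _ Exy Exz) // cxy cxz.
  case: cxy => cxy; first by move=> _; apply: kempea Sx _ Exy cxy; rewrite sx.
  move=> [z [Sz Exz cxz]].
  by rewrite (cp _ _ _ Exy Exz) // cxy cxz.
have nSv : ~ S v.
  by move=> /inv; rewrite (negbTE sv) => -[y [_ Evy cvy]]; exact: (bm y Evy).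
pose sw n := if n == a then b else if n == b then a else n.
have swK : involutive sw.
  by move=> n; rewrite /sw; repeat case: eqP => //; move=> *; congruence.
have swd n : (n < d)%N -> (sw n < d)%N by rewrite /sw; repeat case: eqP.
pose new (p : X * X) := `[< p = (u, v) \/ p = (v, u) >].
(* The swap frees [b] at [u], where [a] was missing, and leaves it free at [v], which is off the
   chain. *)
pose c' p := if new p then b else if `[< S p.1 >] then sw (c p) else c p.
have newE x y : E (x, y) -> new (x, y) = false.
  by move=> Exy; apply/asboolPn => -[E1|E1]; move: Exy; rewrite E1.
have c'E x y : E (x, y) -> c' (x, y) = if `[< S x >] then sw (c (x, y)) else c (x, y).
  by move=> Exy; rewrite /c' newE.
have c'N x y : (x, y) = (u, v) \/ (x, y) = (v, u) -> c' (x, y) = b.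
  by move=> E1; rewrite /c' /new asboolT.
have c'b x y : E (x, y) -> x = u \/ x = v -> c' (x, y) <> b.
  move=> Exy [xE|xE]; subst x; rewrite c'E//.
    rewrite asboolT; last exact: kempe0.
    rewrite /sw; case: eqP => [cy|_]; first by case: (am y Exy).
    by case: eqP => [cy|//] ab; apply: (am y Exy); rewrite cy ab.
  by rewrite asboolF//; exact: bm.
exists c'; split.
- move=> x y [Exy|/c'N->//]; rewrite c'E//; have := cd x y Exy.
  by case: ifP => // _; exact: swd.
- move=> x y [Exy|xy]; last first.
    by rewrite c'N// c'N//; case: xy => -[-> ->]; [right|left].
  rewrite !c'E//; last exact: sE.
  rewrite -(cs _ _ Exy).
  have [ab|nab] := pselect (c (x, y) = a \/ c (x, y) = b).
    have -> // : S x = S y.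
    apply: propext; split=> [Sx|Sy]; first exact: Scl Sx Exy ab.
    by apply: Scl Sy (sE _ _ Exy) _; rewrite -cs.
  have -> : sw (c (x, y)) = c (x, y); last by case: ifP; case: ifP.
  by rewrite /sw; repeat case: eqP => //; move=> ab; case: nab; [left|right].
- move=> x y z [Exy|xy] [Exz|xz].
  + rewrite !c'E//; case: ifP => _; last exact: cp.
    by move=> /(can_inj swK); exact: cp.
  + rewrite [RHS]c'N// => /c'b; case=> //.
    by case: xz => -[-> _]; [left|right].
  + rewrite [LHS]c'N// => /esym/c'b; case=> //.
    by case: xy => -[-> _]; [left|right].
  + move=> _; case: xy => -[xE ->]; case: xz => -[xE' ->] //.
      by move: sv; rewrite -xE' xE su.
    by move: sv; rewrite -xE xE' su.
Qed.

Lemma konig_seq d H side (es : seq (X * X)) : symmetric_set H -> two_sided side H ->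
  degree_le d H -> (forall p, p \in es -> H p) ->
  exists c, coloring d [set p | p \in es \/ (p.2, p.1) \in es] c.
Proof.
move=> sH tH dH; elim: es => [_|[u v] es IH hes]; first by exists (fun _ => 0%N); split=> x y => [[]|[]|z []].
have [|c cE] := IH; first by move=> p pe; apply: hes; rewrite inE pe orbT.
set E := (X in coloring _ X _) in cE.
have sE : symmetric_set E by move=> x y [|] ?; [right|left].
have EH : E `<=` H.
  move=> [x y] [pe|pe]; first by apply: hes; rewrite inE pe orbT.
  by apply: sH; apply: hes; rewrite inE pe orbT.
have Huv : H (u, v) by apply: hes; rewrite inE eqxx.
have Hvu := sH _ _ Huv.
have sub : [set p : X * X | p \in (u, v) :: es \/ (p.2, p.1) \in (u, v) :: es] `<=`
    E `|` [set (u, v); (v, u)].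
  move=> [x y] /=; rewrite !inE => -[/orP[/eqP->|pe]|/orP[/eqP[-> ->]|pe]].
  - by right; left.
  - by left; left.
  - by right; right.
  - by left; right.
have [Euv|nE] := pselect (E (u, v)).
  exists c; apply: coloring_sub cE => p /sub[//|[->//|->]]; exact: sE.
have [su|su] := boolP (side u).
  have [c' hc'] := kempe_extension sE tH dH EH cE Huv Hvu su nE.
  by exists c'; exact: coloring_sub hc'.
have sv : side v by have := tH _ _ Huv; rewrite (negbTE su); case: (side v).
have [|c' hc'] := kempe_extension sE tH dH EH cE Hvu Huv sv; first by move=> /sE.
by exists c'; apply: coloring_sub hc'; rewrite [X in _ `|` X]setUC.
Qed.

Lemma konig_edge_coloring d H side : symmetric_set H -> two_sided side H ->
  degree_le d H -> component_finite H -> exists c, coloring d H c.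
Proof.
move=> sH tH dH fH.
(* The coloring is chosen for the component as a set, so that all its vertices share the same
   one. *)
have /choice[C hC] : forall K : set X, exists c,
    (exists x, K = component H x) -> coloring d (restrict H K) c.
  move=> K; have [[x ->]|nK] := pselect (exists x, K = component H x); last by exists (fun _ => 0%N).
  have [es esE] : exists es : seq (X * X), restrict H (component H x) = [set` es].
    apply/finite_seqP; apply: (sub_finite_set _ (finite_setX (fH x) (fH x))).
    by move=> p [].
  have [|c hc] := konig_seq (es := es) sH tH dH.
    by move=> p pe; have [] : (restrict H (component H x)) p by rewrite esE.
  exists c => _; apply: coloring_sub hc; rewrite esE => p pe; by left.
have hx x : coloring d (restrict H (component H x)) (C (component H x)) by apply: hC; exists x.
have rH x y : H (x, y) -> restrict H (component H x) (x, y).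
  move=> Hxy; split=> //; split; first exact: component_refl.
  exact: component_edge (component_refl H x) Hxy.
exists (fun p => C (component H p.1) p); split=> [x y xy|x y xy|x y z xy xz] /=.
- by have [+ _ _] := hx x; apply; exact: rH.
- rewrite -(component_eq sH (component_edge (component_refl _ _) xy)).
  by have [_ + _] := hx x; apply; exact: rH.
- by have [_ _ +] := hx x; apply; exact: rH.
Qed.

(** Induction on [d]. A matching [M] receives the color [d.-1], leftover edges [L] receive [N], and
    removing both lowers the degree bound by one. [N] is fixed outside the induction so that every
    step reuses it: the [L] of a step avoids [A (3 * d)] for the decreased [d], whereas later steps
    use [N] only within that set. *)
Lemma extend_coloring N side (A : nat -> set X) :
  (forall j, A j `<=` A j.+1) ->
  forall d H c, (d <= N)%N -> symmetric_set H -> two_sided side H -> degree_le d H ->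
  (forall j x y, A j x -> H (x, y) -> A j.+1 y) ->
  component_finite (restrict H (~` A 0%N)) ->
  coloring d (restrict H (A (3 * d)%N)) c ->
  exists f, [/\ coloring N.+1 H f,
    forall x y, H (x, y) -> (f (x, y) < d)%N \/ f (x, y) = N,
    forall x y, H (x, y) -> f (x, y) = N -> A (3 * d)%N x
  & forall x y, H (x, y) -> A 0%N x -> A 0%N y -> f (x, y) = c (x, y)].
Proof.
move=> Amono.
have Ale i j : (i <= j)%N -> A i `<=` A j.
  elim: j => [|j IH]; first by rewrite leqn0 => /eqP->.
  rewrite leq_eqVlt => /orP[/eqP->//|/IH ij]; exact: subset_trans ij (Amono j).
elim=> [|d IH] H c dN sH tH dH AH fH hc.
  have H0 x y : ~ H (x, y).
    by move=> Hxy; have : (size [:: y] <= 0)%N by apply: (dH x) => // z; rewrite inE => /eqP->.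
  by exists (fun _ => 0%N); split=> [|x y /H0|x y /H0|x y /H0] //; split=> x y => [/H0|/H0|z /H0].
have [k [kd ks kp]] : exists k, coloring d.+1 (restrict H (~` A 0%N)) k.
  apply: (konig_edge_coloring (side := side)) fH.
  - exact: symmetric_restrict.
  - by move=> x y [/tH].
  - by apply: degree_le_sub dH => p [].
have hk : coloring d.+1 (restrict H (~` A 0%N)) k by [].
have [cd cs cp] := hc.
have t3 : (3 * d.+1 = (3 * d).+3)%N by lia.
have inA x y : H (x, y) -> A (3 * d).+2 x -> A (3 * d).+2 y -> restrict H (A (3 * d.+1)%N) (x, y).
  by move=> Hxy Ax Ay; rewrite t3; split=> //; split; exact: Amono.
(* The kept class of [c] reaches one layer beyond [A (3 * d).+1], so that it includes all edges of
   this class at a vertex of [A (3 * d).+1]. *)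
pose Min x y := [/\ H (x, y), A (3 * d).+2 x, A (3 * d).+2 y & c (x, y) = d].
pose cov x := exists y, Min x y.
(* Edges within [A (3 * d).+1] are left out, so every edge of [Mout], hence of [L], has both ends
   outside [A (3 * d)]. *)
pose Mout x y := [/\ restrict H (~` A 0%N) (x, y), k (x, y) = d
  & ~ (A (3 * d).+1 x /\ A (3 * d).+1 y)].
pose M x y := Min x y \/ [/\ Mout x y, ~ cov x & ~ cov y].
(* Edges of [Mout] with both ends covered stay in the graph: [Min] already lowers the degree at both
   ends. *)
pose L x y := Mout x y /\ ((cov x /\ ~ cov y) \/ (~ cov x /\ cov y)).
have Mins x y : Min x y -> Min y x.
  move=> [Hxy Ax Ay cxy]; split=> //; first exact: sH.
  by rewrite -cs//; exact: inA.
have Mouts x y : Mout x y -> Mout y x.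
  move=> [xy kxy nA]; split; first exact: symmetric_restrict.
    by rewrite -ks.
  by move=> [Ay Ax]; exact: nA.
have Ms x y : M x y -> M y x by move=> [/Mins|[/Mouts ? ? ?]]; [left|right].
have Ls x y : L x y -> L y x.
  by move=> [/Mouts ? [[? ?]|[? ?]]]; split=> //; [right|left].
have Minp x y z : Min x y -> Min x z -> y = z.
  move=> [xy Ax Ay cy] [xz _ Az cz]; apply: (cp x); rewrite ?cy ?cz//; exact: inA.
have Moutp x y z : Mout x y -> Mout x z -> y = z.
  by move=> [xy ky _] [xz kz _]; apply: (kp x); rewrite ?ky ?kz.
have Mp x y z : M x y -> M x z -> y = z.
  move=> [mxy|[mxy nx _]] [mxz|[mxz nx' _]]; [exact: Minp mxy mxz| | |exact: Moutp mxy mxz].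
    by case: nx'; exists y.
  by case: nx; exists z.
have Lp x y z : L x y -> L x z -> y = z by move=> [+ _] [+ _]; exact: Moutp.
have LnM x y : L x y -> ~ M x y.
  move=> [_ Lxy] [mxy|[_ nx ny]]; last by case: Lxy => -[].
  case: Lxy => -[]; first by move=> _; apply; exists x; exact: Mins.
  by move=> + _; apply; exists y.
pose H' := [set p | [/\ H p, ~ M p.1 p.2 & ~ L p.1 p.2]].
have H'H : H' `<=` H by move=> p [].
have rH' B : restrict H' B `<=` restrict H B by move=> p [/H'H].
have [|||||||f [fN fd fL fc]] := IH H' c; first exact: ltnW.
- by move=> x y [/sH Hyx nM nL]; split=> // [/Ms|/Ls].
- by move=> x y /H'H/tH.
- move=> x s us sH'; rewrite leqNgt; apply/negP => ds.
  have sHx y : y \in s -> H (x, y) by move=> /sH'[].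
  have [Ax|nAx] := pselect (A (3 * d).+1 x).
    have sA y : y \in s -> restrict H (A (3 * d.+1)%N) (x, y).
      by move=> ys; apply: inA; [exact: sHx|exact: Amono|exact: AH Ax (sHx y ys)].
    have [y ys cy] := top_color hc us sA ds.
    have [_ nM _] := sH' y ys; apply: nM; left; split=> //; first exact: sHx.
      exact: Amono.
    exact: AH Ax (sHx y ys).
  have sA y : y \in s -> restrict H (~` A 0%N) (x, y).
    move=> ys; split; first exact: sHx.
    split=> /= A0; apply: nAx; first exact: Ale A0.
    apply: (Ale 1%N) => //; exact: AH A0 (sH _ _ (sHx y ys)).
  have [y ys ky] := top_color hk us sA ds.
  have mxy : Mout x y by split=> //; [exact: sA|case].
  have [_ nM nL] := sH' y ys.
  have [[y0 my0]|nx] := pselect (cov x).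
    (* The removed edge of [Min] at [x] gives a neighbor besides those in [s], which exceeds the
       degree bound. *)
    suff : (size (y0 :: s) <= d.+1)%N by rewrite /= ltnNge ds.
    apply: (dH x).
      rewrite /= us andbT; apply/negP => /sH'[_ nM0 _]; apply: nM0; by left.
    by move=> z; rewrite inE => /orP[/eqP->|/sHx//]; case: my0.
  have [cy|ny] := pselect (cov y); last by apply: nM; right.
  by apply: nL; split=> //; right.
- by move=> j x y Ax /H'H; exact: AH.
- exact: component_finite_sub (rH' _) fH.
- have sub : restrict H' (A (3 * d)%N) `<=` restrict H (A (3 * d.+1)%N).
    have le3 : (3 * d <= 3 * d.+1)%N by lia.
    by move=> p [/H'H Hp [A1 A2]]; split=> //; split; exact: (Ale _ _ le3).
  split=> [x y xy|x y /sub|x y z /sub xy /sub]; [|exact: cs|exact: cp].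
  have := cd x y (sub _ xy); rewrite ltnS leq_eqVlt => /orP[/eqP cy|//].
  case: xy => -[Hxy nM _] [/= Ax Ay]; case: nM; left.
  by split=> //; exact: (Amono _ _ (Amono _ _ _)).
have [fN1 fs fp] := fN.
pose g p := if `[< M p.1 p.2 >] then d else if `[< L p.1 p.2 >] then N else f p.
have gM x y : M x y -> g (x, y) = d by move=> m; rewrite /g asboolT.
have gL x y : L x y -> g (x, y) = N.
  by move=> l; rewrite /g asboolF ?asboolT//; exact: LnM.
have gf x y : ~ M x y -> ~ L x y -> g (x, y) = f (x, y).
  by move=> nm nl; rewrite /g !asboolF.
have cases x y : H (x, y) -> [\/ M x y, L x y | [/\ H' (x, y), ~ M x y & ~ L x y]].
  move=> Hxy; have [m|nm] := pselect (M x y); first by constructor 1.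
  by have [l|nl] := pselect (L x y); [constructor 2|constructor 3].
have dneN : d <> N by lia.
have fd' x y : H' (x, y) -> f (x, y) <> d by move=> /fd[|]; lia.
have LA x y : L x y -> ~ A (3 * d)%N x.
  move=> [[[Hxy _] _ nA] _] Ax; apply: nA; split; first exact: Amono.
  exact: AH Ax Hxy.
exists g; split.
- split=> [x y /cases[/gM->|/gL->|[xy nm nl]]|x y xy|x y z xy xz].
  + lia.
  + by [].
  + by rewrite gf//; exact: fN1.
  + case: (cases _ _ xy) => [m|l|[xy' nm nl]].
    * by rewrite !gM//; exact: Ms.
    * by rewrite !gL//; exact: Ls.
    * rewrite (gf x y)// (gf y x); [exact: fs|by move=> /Ms|by move=> /Ls].
  + case: (cases _ _ xy) => [m|l|[Hxy nm nl]]; case: (cases _ _ xz) => [m'|l'|[Hxz nm' nl']].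
    * by move=> _; exact: Mp m m'.
    * by rewrite (gM x y)// (gL x z).
    * by rewrite (gM x y)// (gf x z)// => /esym /fd'.
    * by rewrite (gL x y)// (gM x z)// => /esym.
    * by move=> _; exact: Lp l l'.
    * by rewrite (gL x y)// (gf x z)// => /esym /(fL _ _ Hxz) /(LA _ _ l).
    * by rewrite (gf x y)// (gM x z)// => /fd'.
    * by rewrite (gf x y)// (gL x z)// => /(fL _ _ Hxy) /(LA _ _ l').
    * by rewrite (gf x y)// (gf x z)//; exact: fp.
- move=> x y /cases[/gM->|/gL->|[xy nm nl]]; [by left|by right|rewrite gf//].
  by case: (fd _ _ xy); [left; lia|right].
- move=> x y /cases[/gM-> //|l _|[xy nm nl]].
    case: l => -[[Hxy _] _ _] [[[z [_ Ax _ _]] _]|[_ [z [_ Ay _ _]]]]; rewrite t3; first exact: Amono.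
    by apply: AH Ay _; exact: sH.
  by rewrite gf// => /(fL _ _ xy); apply: Ale; lia.
- move=> x y /cases[m|[[[_ [/= nA _]] _ _] _]|[xy nm nl]] Ax Ay; last 2 first.
  + by case: nA.
  + by rewrite gf//; exact: fc.
  rewrite gM//; case: m => [[]//|[[[_ [/= nA _]] _ _] _ _]]; by case: nA.
Qed.

End Combinatorics.

(** A repeated vertex cuts a closed walk into two shorter ones, and one of them is odd. *)
Lemma odd_ucycle (T : eqType) (e : rel T) (s : seq T) :
  cycle e s -> odd (size s) -> exists2 s', ucycle e s' & odd (size s').
Proof.
have [n] := ubnP (size s); elim: n s => // n IH s sn cs os.
have [us|nu] := boolP (uniq s); first by exists s => //; apply/andP; split.
have [x [s1 [s2 [s3 sE]]]] : exists x s1 s2 s3, s = s1 ++ x :: s2 ++ x :: s3.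
  elim: s nu {sn cs os} => //= a s IHs; rewrite negb_and negbK => /orP[|/IHs].
    by move=> /splitPr[s2 s3]; exists a, [::], s2, s3.
  by move=> [x [s1 [s2 [s3 ->]]]]; exists x, (a :: s1), s2, s3.
have cs' : path e x (rcons s2 x) /\ path e x (rcons (s3 ++ s1) x).
  move: cs; rewrite -(rot_cycle (size s1)) sE rot_size_cat.
  have -> : (x :: s2 ++ x :: s3) ++ s1 = (x :: s2) ++ (x :: s3 ++ s1) by rewrite /= -catA.
  rewrite /= rcons_cat cat_path /= => /andP[p2 /andP[e2 p3]].
  by rewrite rcons_path p2 e2.
have szE : size s = (size (x :: s2) + size (x :: s3 ++ s1))%N.
  by rewrite sE /= !size_cat /= !size_cat /=; lia.
have [d2|d2] := boolP (odd (size (x :: s2))).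
  by apply: (IH (x :: s2)) d2; [move: szE => /=; lia|exact: cs'.1].
apply: (IH (x :: s3 ++ s1)); [move: szE => /=; lia|exact: cs'.2|].
by move: os; rewrite szE oddD (negbTE d2).
Qed.

(** The side is the parity of a chosen path from a chosen root of the component. An edge between
    equal parities, with the path to one end and the reversed path from the other, closes an odd
    walk. *)
Lemma bipartite_two_sided (X : ptopologicalType) (H : set (X * X)) :
  symmetric_set H -> bipartite H -> exists side, two_sided side H.
Proof.
move=> sH bH.
pose r x := xget point (component H x).
have hr x : component H (r x) x.
  rewrite /r; case: xgetP => [y _ xy|/(_ x)]; first exact: component_sym.
  by case; exact: component_refl.
have rE x y : H (x, y) -> r x = r y.
  move=> xy; rewrite /r (@component_eq _ H x y)//.
  exact: component_edge (component_refl H x) xy.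
have /choice[p hp] x : exists p, path (edge H) (r x) p /\ last (r x) p = x.
  by have [p pp pE] := hr x; exists p.
exists (fun x => odd (size (p x))) => x y xy; apply/negP => /eqP odE.
have se u v : edge H u v = edge H v u.
  by apply/idP/idP => /set_mem/sH/mem_set.
have [px lx] := hp x; have [py ly] := hp y.
pose q := rev (belast (r y) (p y)).
have pq : path (edge H) y q.
  rewrite -[X in path _ X _]ly /q rev_path.
  by rewrite (eq_path (e' := edge H)).
pose w := p x ++ y :: q.
have pw : path (edge H) (r x) w.
  rewrite cat_path px lx /= pq andbT; exact/mem_set.
have lw : last (r x) w = r x.
  rewrite last_cat /= /q (rE _ _ xy); case: (p y) ly => [//|a t] _ /=.
  by rewrite rev_cons last_rcons.
have sw : odd (size w).
  by rewrite size_cat /= size_rev size_belast oddD /= odE addbN addbb.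
case/lastP: w pw lw sw => // w z pw; rewrite last_rcons => zE sw; subst z.
have [||s us os] := @odd_ucycle _ (edge H) (r x :: w) => //.
  by move: sw; rewrite size_rcons.
by have := bH s us; rewrite os.
Qed.

(** Two edges at one vertex colored by different rules both lie within [A 2], where [f] agrees with
    [c]; a clash would already be a clash of [c]. *)
Lemma glue_coloring (X : topologicalType) N (H : set (X * X)) (A : nat -> set X) c f :
  symmetric_set H -> (forall j, A j `<=` A j.+1) ->
  (forall j x y, A j x -> H (x, y) -> A j.+1 y) ->
  coloring N (restrict H (A 2%N)) c -> coloring N (restrict H (~` A 0%N)) f ->
  (forall x y, restrict H (~` A 0%N) (x, y) -> A 2%N x -> A 2%N y -> f (x, y) = c (x, y)) ->
  coloring N H (fun p => if `[< A 1%N p.1 /\ A 1%N p.2 >] then c p else f p).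
Proof.
move=> sH Amono AH [cN cs cp] [fN fs fp] fc.
have in2 x y : H (x, y) -> A 1%N x /\ A 1%N y -> restrict H (A 2%N) (x, y).
  by move=> Hxy [Ax Ay]; split=> //; split; exact: Amono.
have in0 x y : H (x, y) -> ~ (A 1%N x /\ A 1%N y) -> restrict H (~` A 0%N) (x, y).
  move=> Hxy nA; split=> //; split=> /= A0; apply: nA; split.
  - exact: Amono.
  - exact: AH A0 Hxy.
  - exact: AH A0 (sH _ _ Hxy).
  - exact: Amono.
have mixed x y z : H (x, y) -> H (x, z) -> A 1%N x /\ A 1%N y -> ~ (A 1%N x /\ A 1%N z) ->
    c (x, y) = f (x, z) -> y = z.
  move=> xy xz Axy nA; have [_ [nAx nAz]] := in0 _ _ xz nA; have [Ax Ay] := Axy.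
  have Az : A 2%N z by exact: AH Ax xz.
  rewrite fc//; last exact: Amono.
  by apply: cp; [exact: in2|split=> //; split=> //; exact: Amono].
split=> [x y xy|x y xy|x y z xy xz] /=.
- by case: asboolP => [/(in2 _ _ xy)/cN|/(in0 _ _ xy)/fN].
- case: asboolP => Axy; case: asboolP => Ayx; [exact/cs/in2| | |exact/fs/in0].
    by case: Ayx; case: Axy.
  by case: Axy; case: Ayx.
- case: asboolP => Axy; case: asboolP => Axz.
  + by apply: cp; exact: in2.
  + exact: mixed.
  + by move=> /esym fE; apply/esym/(mixed x).
  + by apply: fp; exact: in0.
Qed.

(** * Borel choice of colorings *)

Definition borel_label (S : topologicalType) (l : S -> nat) :=
  forall n, borel [set s | l s = n].

Lemma borel_label_rel (S : topologicalType) (l m : S -> nat) (P : nat -> nat -> Prop) :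
  borel_label l -> borel_label m -> borel [set s | P (l s) (m s)].
Proof.
move=> bl bm.
have -> : [set s | P (l s) (m s)] =
    [set s | exists n : nat * nat, (l s = n.1 /\ m s = n.2) /\ P n.1 n.2].
  apply/seteqP; split=> s /= => [Ps|[n [[-> ->]]]//].
  by exists (l s, m s).
apply: borel_exists => n; apply: borel_and; last exact: borel_cst.
exact: borel_and.
Qed.

Lemma borel_label_comp (S T : topologicalType) (l : T -> nat) (h : S -> T) :
  borel_label l -> borel_map h -> borel_label (l \o h).
Proof. by move=> bl bh n; exact: bh (bl n). Qed.

Lemma borel_map_id (T : topologicalType) : borel_map (@id T).
Proof. by []. Qed.

Section BorelChoice.
Context {X : topologicalType} (V : nat -> set X).
Hypotheses (hX : hausdorff_space X) (hV : regular_basis V).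

Lemma borel_basis n : borel (V n).
Proof. by apply: borel_open; exact: hV.1. Qed.

Lemma basis_separation (x y : X) : x <> y ->
  exists i j, [/\ V i x, V j y & V i `&` V j = set0].
Proof.
move=> /eqP xy; move: hX; rewrite open_hausdorff => /(_ _ _ xy).
move=> [[U W]/= [/set_mem Ux /set_mem Wx] [oU oW /eqP UW]].
have [i [Vi iU]] := hV.2 x U oU Ux; have [j [Vj jW]] := hV.2 y W oW Wx.
exists i, j; split=> //; apply/seteqP; split=> // z [/subset_closure/iU ? /subset_closure/jW ?].
by rewrite -UW.
Qed.

Lemma borel_map_pair (S : topologicalType) (f g : S -> X) :
  borel_map f -> borel_map g -> borel_map (fun s => (f s, g s)).
Proof.
move=> bf bg; apply: borel_map_open => U oU.
have -> : (fun s => (f s, g s)) @^-1` U = [set s | exists n : nat * nat,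
    V n.1 `*` V n.2 `<=` U /\ (V n.1 (f s) /\ V n.2 (g s))].
  apply/seteqP; split=> s /=; last by move=> [n [sub Vs]]; exact: sub.
  move=> Us; have [A1 [B1 [oA oB Ax By AB]]] := open_prodP oU Us.
  have [i [Vi iA]] := hV.2 _ A1 oA Ax; have [j [Vj jB]] := hV.2 _ B1 oB By.
  exists (i, j); split=> // z [/= Vz1 Vz2]; apply: AB; split.
    by apply: iA; exact: subset_closure.
  by apply: jB; exact: subset_closure.
apply: borel_exists => n; apply: borel_and; first exact: borel_cst.
apply: borel_and; [exact: bf (borel_basis _)|exact: bg (borel_basis _)].
Qed.

Lemma borel_map_eq (S : topologicalType) (f g : S -> X) :
  borel_map f -> borel_map g -> borel [set s | f s = g s].
Proof.
move=> bf bg.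
have -> : [set s | f s = g s] = [set s | ~ exists n : nat * nat,
    V n.1 `&` V n.2 = set0 /\ (V n.1 (f s) /\ V n.2 (g s))].
  apply/seteqP; split=> s /=.
    move=> fg [n [V0 [Vf Vg]]]; suff : set0 (f s) by [].
    by rewrite -V0; split=> //; rewrite fg.
  move=> nex; apply: contrapT => /basis_separation[i [j [Vi Vj V0]]].
  by apply: nex; exists (i, j).
apply: borel_not; apply: borel_exists => n; apply: borel_and; first exact: borel_cst.
apply: borel_and; [exact: bf (borel_basis _)|exact: bg (borel_basis _)].
Qed.

Variables (G : set (X * X)) (phi : nat -> X -> X).
Hypotheses (bphi : forall k, borel_map (phi k))
  (Gphi : forall x y, G (x, y) -> exists k, y = phi k x).

Lemma borel_map_edge k : borel_map (fun x => (x, phi k x)).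
Proof. by apply: borel_map_pair => //; exact: borel_map_id. Qed.

Lemma borel_nbr (H Q : set (X * X)) : H `<=` G -> borel H -> borel Q ->
  borel [set x | exists y, H (x, y) /\ Q (x, y)].
Proof.
move=> HG bH bQ.
have -> : [set x | exists y, H (x, y) /\ Q (x, y)] =
    [set x | exists k, H (x, phi k x) /\ Q (x, phi k x)].
  apply/seteqP; split=> x /=; last by move=> [k]; exists (phi k x).
  by move=> [y [Hxy Qxy]]; have [k yE] := Gphi (HG _ Hxy); exists k; rewrite -yE.
apply: borel_exists => k.
apply: borel_and; [exact: (@borel_map_edge k _ bH)|exact: (@borel_map_edge k _ bQ)].
Qed.

Definition thicken (H : set (X * X)) (A : set X) (n : nat) : set X :=
  iter n (fun B => [set x | B x \/ exists y, H (x, y) /\ B y]) A.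

Lemma borel_thicken (H : set (X * X)) A n : H `<=` G -> borel H -> borel A ->
  borel (thicken H A n).
Proof.
move=> HG bH bA; elim: n => //= n IH; apply: borel_or => //.
exact: borel_nbr HG bH (borel_map_snd IH).
Qed.

Lemma saturationE (H : set (X * X)) A x :
  (exists y, component H x y /\ A y) <-> exists n, thicken H A n x.
Proof.
split=> [[y [[p + ->] Ay]]|[n]].
  elim: p x Ay => [|z p IH] x /=; first by move=> ? _; exists 0%N.
  move=> Az /andP[/set_mem Hxz /(IH _ Az)[n nz]].
  by exists n.+1; right; exists z.
elim: n x => [|n IH] x /=; first by move=> Ax; exists x; split=> //; exact: component_refl.
move=> [/IH//|[z [Hxz /IH[y [zy Ay]]]]]; exists y; split=> //.
exact: component_trans (component_edge (component_refl H x) Hxz) zy.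
Qed.

Lemma borel_saturation (H : set (X * X)) A : H `<=` G -> borel H -> borel A ->
  borel [set x | exists y, component H x y /\ A y].
Proof.
move=> HG bH bA.
have -> : [set x | exists y, component H x y /\ A y] = [set x | exists n, thicken H A n x].
  by apply/seteqP; split=> x /saturationE.
by apply: borel_exists => n; exact: borel_thicken.
Qed.

(** A code for a labeling: labeled basic rectangles, the first match deciding. Codes are countably
    many, so a least suitable one can be selected. *)
Fixpoint lookup (s : seq (nat * nat * nat)) (p : X * X) : nat :=
  if s is (a, b, l) :: s' then
    if `[< V a p.1 /\ V b p.2 >] then l else lookup s' p
  else 0%N.

Lemma borel_lookup s : borel_label (lookup s).
Proof.
elim: s => [|[[a b] l] s IH] n /=; first exact: borel_cst.
have bV : borel [set p : X * X | V a p.1 /\ V b p.2].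
  by apply: borel_and; [exact: borel_map_fst (borel_basis a)|exact: borel_map_snd (borel_basis b)].
have -> : [set p | (if `[< V a p.1 /\ V b p.2 >] then l else lookup s p) = n] =
    [set p | ((V a p.1 /\ V b p.2) -> l = n) /\ (~ (V a p.1 /\ V b p.2) -> lookup s p = n)].
  apply/seteqP; split=> p /=; first by case: asboolP => Vp <-; split.
  by case: asboolP => Vp [h1 h2]; [exact: h1|exact: h2].
apply: borel_and; first by apply: borel_imp => //; exact: borel_cst.
by apply: borel_imp; [exact: borel_not|exact: IH].
Qed.

(* Finitely many points have basic neighborhoods isolating them from each other,
   so every labeling of a finite set of edges is given by some code. *)
Lemma lookup_realize (ks : seq X) (g : X * X -> nat) :
  exists s, forall x y, x \in ks -> y \in ks -> lookup s (x, y) = g (x, y).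
Proof.
have /choice[a ha] : forall x, exists i, V i x /\ forall y, y \in ks -> V i y -> y = x.
  move=> x; have fK : finite_set ([set` ks] `\ x) by apply: finite_setD; exact: finite_seq.
  have oK : open (~` ([set` ks] `\ x)).
    apply: closed_openC.
    by move: (hausdorff_accessible hX) => /accessible_finite_set_closed; apply.
  have [|i [Vx iK]] := hV.2 x _ oK; first by move=> [_]; apply.
  exists i; split=> // y yk Vy; apply: contrapT => yx.
  by have := iK _ (subset_closure Vy); apply.
pose row x := [seq (a x, a y, g (x, y)) | y <- ks].
have rowE s x x' y : x' \in ks -> y \in ks ->
    lookup (row x ++ s) (x', y) = if x == x' then g (x', y) else lookup s (x', y).
  move=> xk yk; rewrite /row.
  have -> : (if x == x' then g (x', y) else lookup s (x', y)) =
      if (x == x') && (y \in ks) then g (x', y) else lookup s (x', y) by rewrite yk andbT.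
  elim: {1 2}ks => [|z zs IH] /=; first by rewrite andbF.
  case: asboolP => [[/= Vx Vz]|nV].
    have <- := (ha x).2 _ xk Vx; have <- := (ha z).2 _ yk Vz.
    by rewrite eqxx inE eqxx.
  rewrite IH inE; case: eqP => //= xE; subst x'.
  case: eqP => //= yE; subst z; case: nV; split=> /=; [exact: (ha _).1|exact: (ha _).1].
exists (flatten [seq row x | x <- ks]) => x y xk yk.
have : x \in ks by [].
elim: {1 2}ks => //= z zs IH; rewrite rowE// inE eq_sym.
by case: eqP => //= _; exact: IH.
Qed.

(** Each component takes the least code that colors it correctly. Finiteness of the component
    provides such a code for [f0]. Correctness at a vertex is Borel thanks to [phi], and correctness
    on the component thanks to saturations. The least code is constant on components, so the labels
    glue to one coloring. *)
Lemma borel_coloring_choice N (H W : set (X * X)) (c : X * X -> nat) :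
  H `<=` G -> symmetric_set H -> borel H -> component_finite H ->
  borel W -> borel_label c ->
  (exists2 f0, coloring N H f0 & forall p, H p -> W p -> f0 p = c p) ->
  exists f, [/\ borel_label f, coloring N H f & forall p, H p -> W p -> f p = c p].
Proof.
move=> HG sH bH fH bW bc [f0 [f0N f0s f0p] f0c].
pose L n := if unpickle n is Some s then lookup s else lookup [::].
have bL n : borel_label (L n) by rewrite /L; case: unpickle => [s|]; exact: borel_lookup.
pose Q n y := forall k, H (y, phi k y) ->
  [/\ (L n (y, phi k y) < N)%N, L n (y, phi k y) = L n (phi k y, y),
      W (y, phi k y) -> L n (y, phi k y) = c (y, phi k y)
    & forall j, H (y, phi j y) -> L n (y, phi k y) = L n (y, phi j y) -> phi k y = phi j y].
have bE k : borel_map (fun x => (x, phi k x)) := @borel_map_edge k.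
have bE' k : borel_map (fun x => (phi k x, x)).
  by apply: borel_map_pair => //; exact: borel_map_id.
have bQ n : borel [set y | Q n y].
  apply: borel_forall => k; apply: borel_imp; first exact: bE bH.
  have bLk j : borel_label (fun y => L n (y, phi j y)) := borel_label_comp (bL n) (bE j).
  rewrite (_ : [set _ | _] = [set y | ((L n (y, phi k y) < N)%N /\
      L n (y, phi k y) = L n (phi k y, y)) /\
      ((W (y, phi k y) -> L n (y, phi k y) = c (y, phi k y)) /\
      forall j, H (y, phi j y) -> L n (y, phi k y) = L n (y, phi j y) -> phi k y = phi j y)]).
    apply: borel_and; apply: borel_and.
    - exact: (borel_label_rel (fun u _ => (u < N)%N) (bLk k) (bLk k)).
    - exact: (borel_label_rel eq (bLk k) (borel_label_comp (bL n) (bE' k))).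
    - apply: borel_imp; first exact: bE bW.
      exact: (borel_label_rel eq (bLk k) (borel_label_comp bc (bE k))).
    - apply: borel_forall => j; apply: borel_imp; first exact: bE bH.
      apply: borel_imp; first exact: (borel_label_rel eq (bLk k) (bLk j)).
      exact: borel_map_eq.
  by apply/seteqP; split=> y /= => [[]|[[] ? ? []]].
pose ok n x := forall y, component H x y -> Q n y.
have bok n : borel [set x | ok n x].
  have -> : [set x | ok n x] = [set x | ~ exists y, component H x y /\ ~ Q n y].
    apply/seteqP; split=> x /= okx; first by move=> [y [xy]]; apply; exact: okx.
    by move=> y xy; apply: contrapT => nQ; apply: okx; exists y.
  by apply: borel_not; apply: borel_saturation => //; exact: borel_not.
have exok x : exists n, `[< ok n x >].
  have [ks ksE] : exists ks : seq X, component H x = [set` ks] by apply/finite_seqP; exact: fH.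
  have inK y : component H x y -> y \in ks by rewrite ksE.
  have [s hs] := lookup_realize ks f0.
  exists (pickle s); apply/asboolP => y xy k Hk.
  have yk := inK y xy; have kk := inK _ (component_edge xy Hk).
  rewrite /L pickleK; split; rewrite ?hs//.
  - exact: f0N.
  - exact: f0s.
  - exact: f0c.
  - move=> j Hj; have jk := inK _ (component_edge xy Hj).
    by rewrite hs//; exact: f0p.
pose i x := ex_minn (exok x).
have iP x : ok (i x) x by rewrite /i; case: ex_minnP => n /asboolP.
have imin x n : ok n x -> (i x <= n)%N.
  by move=> okx; rewrite /i; case: ex_minnP => m _; apply; exact/asboolP.
have bi : borel_label i.
  move=> n; have -> : [set x | i x = n] = [set x | ok n x /\ forall m, (m < n)%N -> ~ ok m x].
    apply/seteqP; split=> x /=; first move=> <-.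
      by split=> [|m mi /imin]; [exact: iP|rewrite leqNgt mi].
    move=> [okx nok]; apply/eqP; rewrite eqn_leq imin//= leqNgt; apply/negP => /nok; apply.
    exact: iP.
  apply: borel_and; first exact: bok.
  apply: borel_forall => m; apply: borel_imp; first exact: borel_cst.
  by apply: borel_not; exact: bok.
have iE x y : H (x, y) -> i x = i y.
  move=> xy; suff E n : ok n x <-> ok n y.
    by apply/eqP; rewrite eqn_leq !imin//; apply/E; exact: iP.
  by rewrite /ok (component_eq sH (component_edge (component_refl H x) xy)).
have LP x y : H (x, y) -> exists k, y = phi k x by move=> /HG/Gphi.
exists (fun p => L (i p.1) p); split.
- move=> n.
  have -> : [set p | L (i p.1) p = n] = [set p : X * X | exists j, i p.1 = j /\ L j p = n].
    by apply/seteqP; split=> p /= => [Ln|[j [<-]]//]; exists (i p.1).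
  apply: borel_exists => j; apply: borel_and; last exact: bL.
  exact: (borel_label_comp bi (@borel_map_fst X X)).
- split=> [x y xy|x y xy|x y z xy xz] /=.
  + have [k yE] := LP _ _ xy; subst y.
    by have [] := iP x x (component_refl H x) k xy.
  + rewrite -(iE x y xy); have [k yE] := LP _ _ xy; subst y.
    by have [] := iP x x (component_refl H x) k xy.
  + have [k yE] := LP _ _ xy; have [j zE] := LP _ _ xz; subst y z.
    by have [_ _ _] := iP x x (component_refl H x) k xy; apply.
- move=> [x y] xy /=; have [k yE] := LP _ _ xy; subst y.
  by have [] := iP x x (component_refl H x) k xy.
Qed.

(* A color prescribes disjoint basic sets for the two ends, and the functions
   [phi] that compute each end from the other. *)
Lemma countable_borel_coloring : borel G -> symmetric_set G -> (forall x, ~ G (x, x)) ->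
  exists c : X * X -> nat,
  [/\ forall n, borel (G `&` [set p | c p = n]),
      forall x y, G (x, y) -> c (x, y) = c (y, x)
    & forall x y z, G (x, y) -> G (x, z) -> y <> z -> c (x, y) <> c (x, z)].
Proof.
move=> bG sG iG.
pose half (p : nat * nat * (nat * nat)) (x y : X) :=
  (V p.2.1 x /\ V p.2.2 y) /\ (y = phi p.1.1 x /\ x = phi p.1.2 y).
pose good p x y := V p.2.1 `&` V p.2.2 = set0 /\ (half p x y \/ half p y x).
pose goodn n x y := if unpickle n is Some p then good p x y else False.
have goodC n x y : goodn n x y -> goodn n y x.
  by rewrite /goodn; case: unpickle => // p [V0 [|]]; split=> //; [right|left].
have ex (p : X * X) : exists n, `[< goodn n p.1 p.2 \/ ~ G p >].
  case: p => x y; have [Gxy|nG] := pselect (G (x, y)); last by exists 0%N; apply/asboolP; right.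
  have [n yE] := Gphi Gxy; have [m xE] := Gphi (sG _ _ Gxy).
  have [|i [j [Vi Vj V0]]] := @basis_separation x y; first by move=> xy; apply: (iG x); rewrite {2}xy.
  exists (pickle ((n, m), (i, j))); apply/asboolP; left.
  by rewrite /goodn pickleK; split=> //; left.
pose c p := ex_minn (ex p).
have cg x y : G (x, y) -> goodn (c (x, y)) x y.
  by move=> Gxy; rewrite /c; case: ex_minnP => n /asboolP[].
have cmin x y n : goodn n x y -> (c (x, y) <= n)%N.
  by move=> gn; rewrite /c; case: ex_minnP => m _; apply; apply/asboolP; left.
have bhalf p : borel [set q : X * X | half p q.1 q.2].
  apply: borel_and; apply: borel_and.
  - exact: borel_map_fst (borel_basis _).
  - exact: borel_map_snd (borel_basis _).
  - apply: borel_map_eq; first exact: borel_map_snd.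
    exact: (borel_map_comp (bphi _) (@borel_map_fst X X)).
  - apply: borel_map_eq; first exact: borel_map_fst.
    exact: (borel_map_comp (bphi _) (@borel_map_snd X X)).
have bhalf' p : borel [set q : X * X | half p q.2 q.1].
  apply: borel_and; apply: borel_and.
  - exact: borel_map_snd (borel_basis _).
  - exact: borel_map_fst (borel_basis _).
  - apply: borel_map_eq; first exact: borel_map_fst.
    exact: (borel_map_comp (bphi _) (@borel_map_snd X X)).
  - apply: borel_map_eq; first exact: borel_map_snd.
    exact: (borel_map_comp (bphi _) (@borel_map_fst X X)).
have bgood n : borel [set q : X * X | goodn n q.1 q.2].
  rewrite /goodn; case: unpickle => [p|]; last exact: borel0.
  by apply: borel_and; [exact: borel_cst|exact: borel_or].
exists c; split.
- move=> n; rewrite (_ : _ `&` _ = [set q | G q /\ (goodn n q.1 q.2 /\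
      forall m, (m < n)%N -> ~ goodn m q.1 q.2)]).
    apply: borel_and => //; apply: borel_and => //.
    apply: borel_forall => m; apply: borel_imp; first exact: borel_cst.
    exact: borel_not.
  apply/seteqP; split=> -[x y] /= [Gxy].
    by move=> <-; split=> //; split=> [|m mc /cmin]; [exact: cg|rewrite leqNgt mc].
  move=> [gn nm]; split=> //; apply/eqP; rewrite eqn_leq cmin//= leqNgt.
  by apply/negP => /nm; apply; exact: cg.
- move=> x y Gxy; apply/eqP; rewrite eqn_leq !cmin//; apply: goodC; apply: cg => //.
  exact: sG.
- move=> x y z Gxy Gxz yz cE; apply: yz.
  have := cg x z Gxz; rewrite -cE; have := cg x y Gxy.
  rewrite /goodn; case: unpickle => // p [V0 hy] [_ hz].
  (* For equal colors, disjointness of the basic sets makes [x] the same end of both edges; the same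
     map then computes [y] and [z]. *)
  have nVV : V p.2.1 x -> V p.2.2 x -> False.
    by move=> V1 V2; suff : set0 x by []; rewrite -V0.
  case: hy => -[[Vx Vy] [yE xE]]; case: hz => -[[Vx' Vz] [zE xE']].
  + by rewrite yE zE.
  + by case: nVV.
  + by case: nVV.
  + by rewrite xE' xE.
Qed.

End BorelChoice.

(** * Separators *)

Lemma finite_set_eventually (T : Type) (S : set T) (P : nat -> T -> Prop) :
  finite_set S -> (forall m n x, (m <= n)%N -> P m x -> P n x) ->
  (forall x, S x -> exists n, P n x) -> exists n, forall x, S x -> P n x.
Proof.
move=> fS mono ex.
have /choice[f hf] x : exists n, S x -> P n x.
  by have [/ex[n ?]|nS] := pselect (S x); [exists n|exists 0%N].
have [k [g gE]] : exists k, exists g : nat -> nat, f @` S `<=` g @` `I_k.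
  have /finite_setP[k] : finite_set (f @` S) by exact: finite_image.
  by move=> /card_esym/card_set_bijP[g [_ _ gs]]; exists k, g.
exists (\max_(i < k) g i) => x Sx.
have [i ik gi] : (g @` `I_k) (f x) by apply: gE; exists x.
apply: mono (hf x Sx); rewrite -gi.
exact: (leq_bigmax (Ordinal ik)).
Qed.

Section Thicken.
Context {X : topologicalType}.
Implicit Types (H : set (X * X)) (A B : set X).

Lemma thicken_le H A m n : (m <= n)%N -> thicken H A m `<=` thicken H A n.
Proof.
elim: n => [|n IH]; first by rewrite leqn0 => /eqP->.
by rewrite leq_eqVlt => /orP[/eqP->//|/IH mn] x /mn ?; left.
Qed.

Lemma thicken_sub H A B n : A `<=` B -> thicken H A n `<=` thicken H B n.
Proof.
move=> AB; elim: n => //= n IH x [/IH|[y [xy /IH]]]; first by left.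
by right; exists y.
Qed.

Lemma thickenP H A n x : thicken H A n x <-> exists2 y, A y & thicken H [set y] n x.
Proof.
split=> [|[y Ay]]; last by apply: thicken_sub => _ ->.
elim: n x => [|n IH] x /=; first by exists x.
move=> [/IH[y Ay xy]|[z [xz /IH[y Ay zy]]]]; exists y => //; first by left.
by right; exists z.
Qed.

Lemma thicken_trans H m n x y z :
  thicken H [set y] n x -> thicken H [set z] m y -> thicken H [set z] (n + m) x.
Proof.
move=> xy yz; rewrite /thicken iterD -/(thicken _ _ m) -/(thicken _ _ n).
by apply: thicken_sub xy => _ ->.
Qed.

Lemma thicken_step H A n x y : symmetric_set H ->
  thicken H A n x -> H (x, y) -> thicken H A n.+1 y.
Proof. by move=> sH xA /sH yx; right; exists x. Qed.

Lemma thicken_sym H n x y : symmetric_set H ->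
  thicken H [set y] n x -> thicken H [set x] n y.
Proof.
move=> sH; elim: n x y => [|n IH] x y /=; first by move=> ->.
move=> [/IH|[z [xz /IH yz]]]; first by left.
have zx : thicken H [set x] 1 z by right; exists x; split=> //; exact: sH.
by have := thicken_trans yz zx; rewrite addn1.
Qed.

End Thicken.

Section Separator.
Context {X : topologicalType} (G : set (X * X)) (F : nat -> set (X * X)).
Hypotheses (sG : symmetric_set G)
  (fF : forall n, component_finite (F n)) (Fmono : forall n, F n `<=` F n.+1).

Definition boundary n : set X := [set x | exists y, G (x, y) /\ ~ F n (x, y)].

Lemma boundary_anti m n : (m <= n)%N -> boundary n `<=` boundary m.
Proof.
move=> mn x [y [Gxy nF]]; exists y; split=> // Fm; apply: nF.
elim: n mn => [|n IH]; first by rewrite leqn0 => /eqP<-.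
by rewrite leq_eqVlt => /orP[/eqP<-//|/IH/Fmono].
Qed.

(** Local finiteness: only finitely many edges lie near [x], and a single [F n] contains them
    all. *)
Lemma thicken_boundary_escape R x : (forall x, finite_set [set y | G (x, y)]) ->
  G `<=` \bigcup_n F n -> exists n, ~ thicken G (boundary n) R x.
Proof.
move=> fG GF; elim: R x => [|R IH] x.
  have [||n hn] :=
    @finite_set_eventually _ [set y | G (x, y)] (fun n y => F n (x, y)) (fG x).
  - move=> m n y mn Fm; elim: n mn => [|n IH]; first by rewrite leqn0 => /eqP<-.
    by rewrite leq_eqVlt => /orP[/eqP<-//|/IH/Fmono].
  - by move=> y /GF[k _ Fk]; exists k.
  by exists n => -[y [/hn]].
have anti m n y : (m <= n)%N -> ~ thicken G (boundary m) R y -> ~ thicken G (boundary n) R y.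
  by move=> mn nm tn; apply: nm; apply: thicken_sub tn; exact: boundary_anti.
have [|n hn] := @finite_set_eventually _ [set y | G (x, y)]
    (fun n y => ~ thicken G (boundary n) R y) (fG x) anti; first by move=> y _; exact: IH.
have [m hm] := IH x; exists (maxn m n) => -[tx|[y [Gxy ty]]].
  by apply: (anti m (maxn m n) x) => //; exact: leq_maxl.
by apply: (anti n (maxn m n) y) => //; [exact: leq_maxr|exact: hn].
Qed.

Variables (nn : nat -> nat) (r : nat).
Hypothesis nn_mono : forall k, (nn k < nn k.+1)%N.
(** Two radii and one edge: beyond this distance, [r]-neighborhoods neither meet nor are
    adjacent. *)
Let R := (r + r).+1.

(* The [F (nn k)]-boundary, except where it comes close to the next one. *)
Definition separator : set X :=
  \bigcup_k (boundary (nn k) `\` thicken G (boundary (nn k.+1)) R).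

(** Pieces of different index are more than [R] apart, so a component stays near a single piece [k].
    That piece is far from the boundary of [F (nn k.+1)], so no edge of the component leaves
    [F (nn k.+1)]. *)
Lemma thicken_separator_finite : component_finite (restrict G (thicken G separator r)).
Proof.
have nnle i j : (i <= j)%N -> (nn i <= nn j)%N.
  elim: j => [|j IH]; first by rewrite leqn0 => /eqP->.
  rewrite leq_eqVlt => /orP[/eqP->//|/IH/leq_trans]; apply; exact: ltnW.
pose S k := boundary (nn k) `\` thicken G (boundary (nn k.+1)) R.
have far i j s s' : (i < j)%N -> S i s -> S j s' -> ~ thicken G [set s'] R s.
  move=> ij [_ nD] [Ds' _] ss'; apply: nD; apply/thickenP; exists s' => //.
  by apply: boundary_anti Ds'; exact: nnle.
move=> x; have [/thickenP[s [k _ Sks] xs]|nx] := pselect (thicken G separator r x).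
  apply: sub_finite_set (fF (nn k.+1) x) => y xy.
  suff [] : component (F (nn k.+1)) x y /\ exists2 t, S k t & thicken G [set t] r y by [].
  apply: (component_ind (P := fun y => component (F (nn k.+1)) x y /\
    exists2 t, S k t & thicken G [set t] r y) xy).
    by split; [exact: component_refl|exists s].
  move=> u v _ [xu [t Skt ut]] [Guv [/= _ /thickenP[t' [j _ Sjt'] vt']]].
  have tt' : thicken G [set t'] R t.
    have tu := thicken_sym sG ut.
    have uv : thicken G [set v] 1 u by right; exists v.
    have := thicken_trans (thicken_trans tu uv) vt'.
    by rewrite /R addn1 addSn.
  have jk : j = k.
    have [jk|kj|//] := ltngtP j k; last by have := far k j t t' kj Skt Sjt'.
    by have := far j k t' t jk Sjt' Skt; case; exact: thicken_sym.
  subst j; split; last by exists t'.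
  apply: (component_edge xu); apply: contrapT => nF.
  case: Skt => _; apply; apply/thickenP; exists u; first by exists v.
  by apply: thicken_le (thicken_sym sG ut); rewrite /R; lia.
apply: sub_finite_set (finite_set1 x) => y xy.
apply: (component_ind (P := fun y => y = x) xy) => // u v _ -> [_ [/= ux _]].
by case: nx.
Qed.

(** An edge outside [F (nn k)] starts at a boundary point of [F (nn k)]; in a component where the
    next boundary is far away, that point belongs to the separator. Off the separator, a component
    is thus confined to one of [F (nn k)]. *)
Lemma separator_complement_finite (C : set X) :
  (forall x, C x -> exists k, forall y, component (F (nn k)) x y ->
     ~ thicken G (boundary (nn k.+1)) R y) ->
  component_finite (restrict (restrict G C) (~` separator)).
Proof.
move=> hC x; have [/hC[k hk]|nCx] := pselect (C x).
  apply: sub_finite_set (fF (nn k) x) => y xy.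
  apply: (component_ind xy) => [|u v _ xu [[Guv _] [/= nu _]]]; first exact: component_refl.
  apply: (component_edge xu); apply: contrapT => nF; apply: nu.
  by exists k => //; split; [exists v|exact: (hk u xu)].
apply: sub_finite_set (finite_set1 x) => y xy.
apply: (component_ind (P := fun y => y = x) xy) => // u v _ -> [[_ [/= Cx _]] _].
by case: nCx.
Qed.

End Separator.

(** Continuity from above lets [nn k.+1] be chosen after [nn k] with measure at most [2 ^ -(k+1)];
    the sum is finite and Borel-Cantelli applies. *)
Lemma null_limsup_subsequence (R : realType) d (T : measurableType d)
    (mu : probability T R) (E : nat -> nat -> set T) :
  (forall m n, measurable (E m n)) ->
  (forall m i j, (i <= j)%N -> E m j `<=` E m i) ->
  (forall m, \bigcap_n E m n = set0) ->
  exists2 nn : nat -> nat, forall k, (nn k < nn k.+1)%N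
    & mu (lim_sup_set (fun k => E (nn k) (nn k.+1))) = 0%E.
Proof.
move=> mE anti E0.
have /choice[next hnext] : forall p : nat * nat, exists n, (p.2 < n)%N /\
    (mu (E p.2 n) <= (1 / (2 ^ p.1.+1)%:R)%:E)%E.
  move=> [k m] /=; set e := (1 / _)%R.
  have e0 : (0 < e)%R by rewrite /e divr_gt0 ?ltr0n ?expn_gt0.
  have cv : (mu \o E m) n @[n --> \oo] --> (0 : \bar R)%E.
    rewrite -(measure0 mu) -(E0 m); apply: nonincreasing_cvg_mu => //.
    - exact: le_lt_trans (probability_le1 mu (mE m 0%N)) (ltry _).
    - by rewrite E0.
    - by move=> i j ij; apply/subsetPset; exact: anti.
  have /cv[N _ hN] : nbhs (0 : \bar R)%E [set y | (y < e%:E)%E].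
    apply: open_nbhs_nbhs; split; first exact: open_ereal_lt_ereal.
    by rewrite /= lte_fin.
  exists (maxn N m.+1); split; first exact: leq_maxr.
  by apply/ltW/hN; exact: leq_maxl.
pose nn := fix nn k := if k is k'.+1 then next (k', nn k') else 0%N.
exists nn => [k|]; first exact: (hnext (k, nn k)).1.
apply: lim_sup_set_cvg0 => [k|]; first exact: mE.
apply: le_lt_trans (ltry 1%R).
apply: le_trans (epsilon_trick0 xpredT (ler01 : (0 <= 1 :> R)%R)).
by apply: lee_nneseries => k _ //; exact: (hnext (k, nn k)).2.
Qed.

Lemma coloring_weaken (X : topologicalType) M N (H : set (X * X)) c :
  (M <= N)%N -> coloring M H c -> coloring N H c.
Proof. by move=> MN [cM ? ?]; split=> // x y /cM/leq_trans; apply. Qed.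

(** * Borel edge colorings for finite maximum degree *)

Section FiniteDegree.
Variables (R : realType) (X : ptopologicalType) (hX : polish R X).
Variable mu : probability (g_sigma_algebraType (@open X)) R.
Variable G : set (X * X).
Hypotheses (hG : borel_graph G) (hbip : bipartite G) (hhyp : mu_hyperfinite mu G).

Lemma invariant_closed C x y : Defs.invariant G C -> C x -> G (x, y) -> C y.
Proof.
by move=> [A ->] [a Aa ax] Gxy; exists a => //; exact: component_edge ax Gxy.
Qed.

Lemma closed_invariant C : (forall x y, C x -> G (x, y) -> C y) -> Defs.invariant G C.
Proof.
move=> hC; exists C; apply/seteqP; split=> x; first by exists x => //; exact: component_refl.
by move=> [a Ca ax]; apply: (component_ind ax) => // u v _; exact: hC.
Qed.

Lemma borel_restrict (H : set (X * X)) (A : set X) :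
  borel H -> borel A -> borel (restrict H A).
Proof.
move=> bH bA; apply: borel_and => //.
by apply: borel_and; [exact: borel_map_fst bA|exact: borel_map_snd bA].
Qed.

Lemma hyperfinite_enumeration (H : set (X * X)) : hyperfinite H ->
  exists phi : nat -> X -> X, (forall k, borel_map (phi k)) /\
    forall x y, H (x, y) -> exists k, y = phi k x.
Proof.
move=> [F [bF fF _ HE]]; have [hausX [V hV] sX] := polish_regular_basis hX.
apply: (borel_enumeration hausX hV sX (F := F)) => // [n|n x]; first by have [] := bF n.
apply: sub_finite_set (fF n x) => y Fxy.
exact: component_edge (component_refl _ _) Fxy.
Qed.

Lemma mu_hyperfinite_coloring d : degree_le d G ->
  (forall x, finite_set [set y | G (x, y)]) ->
  exists C c, [/\ conull_invariant_borel mu G C, borel_label c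
    & coloring d.+1 (restrict G C) c].
Proof.
move=> dG fG; have [hausX [V hV] sX] := polish_regular_basis hX.
have [bG sG iG] := hG.
have [C [bC muC iC] hypC] := hhyp.
have [phi [bphi Gphi]] := hyperfinite_enumeration hypC.
have [F [bF fF Fmono GE]] := hypC.
set K := restrict G C in hypC Gphi GE.
have bK : borel K by exact: borel_restrict.
have sK : symmetric_set K by exact: symmetric_restrict.
have fK x : finite_set [set y | K (x, y)] by apply: sub_finite_set (fG x) => y [].
have bFn n : borel (F n) by have [] := bF n.
have FK n : F n `<=` K by rewrite GE => p Fp; exists n.
have bD n : borel (boundary K F n).
  have -> : boundary K F n = [set x | exists y, K (x, y) /\ [set p | ~ F n p] (x, y)] by [].
  by apply: (borel_nbr hV bphi Gphi) => //; apply: borel_not; exact: bFn.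
have [side hside] := bipartite_two_sided sG hbip.
pose r := (3 * d).+2; pose rr := (r + r).+1.
(* The vertices whose [F m]-component comes close to the boundary of [F n]. For fixed [m] these sets
   decrease to the empty set, components being finite. *)
pose E m n := [set x | exists y, component (F m) x y /\ thicken K (boundary K F n) rr y].
have bth n : borel (thicken K (boundary K F n) rr).
  exact: (borel_thicken hV bphi Gphi).
have bE m n : borel (E m n) by exact: (borel_saturation hV bphi Gphi).
have antith i j : (i <= j)%N ->
    thicken K (boundary K F j) rr `<=` thicken K (boundary K F i) rr.
  by move=> ij; apply: thicken_sub; exact: boundary_anti.
have [|||nn nn_mono muE] := @null_limsup_subsequence _ _ _ mu E.
- exact: bE.
- by move=> m i j ij x [y [xy ty]]; exists y; split=> //; exact: antith ty.
- move=> m; apply/seteqP; split=> // x Ex.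
  have [||n hn] := @finite_set_eventually _ (component (F m) x)
      (fun n y => ~ thicken K (boundary K F n) rr y) (fF m x).
  + by move=> i j y ij ni tj; apply: ni; exact: antith ij _ tj.
  + move=> y _; apply: thicken_boundary_escape => //; rewrite GE //.
  by have [y [xy ty]] := Ex n I; have := hn y xy.
pose bad := lim_sup_set (fun k => E (nn k) (nn k.+1)).
have bbad : borel bad.
  have -> : bad = [set x | forall n, exists j, (n <= j)%N /\ E (nn j) (nn j.+1) x].
    apply/seteqP; split=> x bx n; first by have [j nj Ej] := bx n I; exists j.
    by move=> _; have [j [nj Ej]] := bx n; exists j.
  apply: borel_forall => n; apply: borel_exists => j.
  by apply: borel_and; [exact: borel_cst|exact: bE].
pose C' := C `&` ~` bad.
have badP x : ~ bad x <-> exists n, forall k, (n <= k)%N -> ~ E (nn k) (nn k.+1) x.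
  split=> [nb|[n hn] bx]; last by have [k nk Ek] := bx n I; exact: hn nk Ek.
  apply: contrapT => nex; apply: nb => n _; apply: contrapT => nj; apply: nex.
  by exists n => k nk Ek; apply: nj; exists k.
have nnle k : (k <= nn k)%N.
  by elim: k => // k IH; exact: leq_ltn_trans IH (nn_mono k).
have Fle m n : (m <= n)%N -> F m `<=` F n.
  elim: n => [|n IH]; first by rewrite leqn0 => /eqP->.
  rewrite leq_eqVlt => /orP[/eqP->//|/IH mn]; exact: subset_trans mn (Fmono n).
have C'cl x y : C' x -> G (x, y) -> C' y.
  move=> [Cx /badP[n hn]] Gxy; have Cy : C y by exact: invariant_closed iC Cx Gxy.
  split=> //; apply/badP.
  (* Once the edge has entered [F], both ends have the same component; [bad] depends only on such
     late indices. *)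
  have [m _ Fm] : (\bigcup_n F n) (x, y) by rewrite -GE; split.
  exists (maxn m n) => k mnk [z [yz tz]]; apply: (hn k).
    exact: leq_trans (leq_maxr _ _) mnk.
  exists z; split=> //; apply: component_trans yz.
  apply: component_edge (component_refl _ _) _; apply: Fle Fm.
  apply: leq_trans (nnle k); exact: leq_trans (leq_maxl _ _) mnk.
have cC' : conull_invariant_borel mu G C'.
  split; first by apply: borel_and => //; exact: borelC.
    rewrite /C' setCI setCK.
    by rewrite measureU0//; exact: borelC.
  exact: closed_invariant.
set K' := restrict G C'.
have K'K : K' `<=` K by move=> p [Gp [[C1 _] [C2 _]]].
have bK' : borel K' by apply: borel_restrict => //; have [] := cC'.
have sK' : symmetric_set K' by exact: symmetric_restrict.
have K'G : K' `<=` G by move=> p [].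
have side' : two_sided side K' by move=> x y /K'G; exact: hside.
have dK' : degree_le d K' by exact: degree_le_sub dG.
pose S := separator K F nn r.
have bS : borel S.
  by apply: borel_bigcup => k; apply: borel_and; [exact: bD|exact: borelC].
pose A j := thicken K S j.
have bA j : borel (A j) by exact: (borel_thicken hV bphi Gphi).
have Amono j : A j `<=` A j.+1 by exact: thicken_le.
have Ale i j : (i <= j)%N -> A i `<=` A j by exact: thicken_le.
have AK' j x y : A j x -> K' (x, y) -> A j.+1 y.
  by move=> Ax /K'K; exact: thicken_step.
have fin_in : component_finite (restrict K' (A r)).
  apply: component_finite_sub (@thicken_separator_finite _ _ _ sK fF Fmono nn r nn_mono).
  by move=> p [/K'K Kp ?].
have fin_out : component_finite (restrict K' (~` A 0%N)).
  have fin_C : component_finite (restrict (restrict K C') (~` separator K F nn r)).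
    apply: separator_complement_finite => // x [_ /badP[n hn]]; exists n => y xy ty.
    by apply: (hn n (leqnn n)); exists y.
  apply: component_finite_sub fin_C => p [K'p Ap]; split=> //.
  by split; [exact: K'K|case: K'p].
have [c0 hc0] : exists c, coloring d (restrict K' (A r)) c.
  apply: (konig_edge_coloring (side := side)) fin_in.
  - exact: symmetric_restrict.
  - by move=> x y [/side'].
  - by apply: degree_le_sub dK' => p [].
have bcst : borel_label (fun _ : X * X => 0%N) by move=> n; exact: borel_cst.
have [|||||||c [bc hc _]] := @borel_coloring_choice _ V hausX hV K phi bphi Gphi d
    (restrict K' (A r)) set0 (fun _ => 0%N).
- by move=> p [/K'K].
- exact: symmetric_restrict.
- exact: borel_restrict.
- exact: fin_in.
- exact: borel0.
- exact: bcst.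
- by exists c0.
(* The layers are shifted by two: the top layer becomes [A r], and agreement with [c] holds on
   [A 2], as the gluing requires. With [N = d] the extra color is the last of [d.+1]. *)
have [||||||f [hf _ _ fc]] := @extend_coloring _ d side (fun j => A j.+2)
    (fun j => Amono j.+2) d K' c (leqnn d).
- exact: sK'.
- exact: side'.
- exact: dK'.
- by move=> j; exact: AK'.
- apply: component_finite_sub fin_out => p [K'p [n1 n2]]; split=> //.
  by split=> A0; [apply: n1|apply: n2]; exact: (Ale 0%N 2%N).
- exact: hc.
(* [f] need not be Borel; it only witnesses that [c] on [A 2] extends to the complement of [A 0]. *)
have [|||||||f' [bf' hf' f'c]] := @borel_coloring_choice _ V hausX hV K phi bphi Gphi d.+1
    (restrict K' (~` A 0%N)) (A 2%N `*` A 2%N) c.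
- by move=> p [/K'K].
- exact: symmetric_restrict.
- by apply: borel_restrict => //; exact: borelC.
- exact: fin_out.
- by apply: borel_and; [exact: borel_map_fst (bA _)|exact: borel_map_snd (bA _)].
- exact: bc.
- exists f; first by apply: coloring_sub hf => p [].
  by move=> [x y] [K'xy _] [Ax Ay]; exact: fc.
exists C', (fun p => if `[< A 1%N p.1 /\ A 1%N p.2 >] then c p else f' p); split=> //.
  move=> n.
  have -> : [set p : X * X | (if `[< A 1%N p.1 /\ A 1%N p.2 >] then c p else f' p) = n] =
    [set p | ((A 1%N p.1 /\ A 1%N p.2) -> c p = n) /\
             (~ (A 1%N p.1 /\ A 1%N p.2) -> f' p = n)].
    apply/seteqP; split=> p /=; first by case: asboolP => Ap <-; split.
    by case: asboolP => Ap [h1 h2]; [exact: h1|exact: h2].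
  have bA1 : borel [set p : X * X | A 1%N p.1 /\ A 1%N p.2].
    by apply: borel_and; [exact: borel_map_fst (bA _)|exact: borel_map_snd (bA _)].
  apply: borel_and; first by apply: borel_imp => //; exact: bc.
  by apply: borel_imp; [exact: borel_not|exact: bf'].
apply: glue_coloring => //.
  apply: coloring_weaken (leqnSn d) _; apply: coloring_sub hc => p [K'p [A1 A2]].
  by split=> //; split; apply: (Ale 2%N r) => //; rewrite /r; lia.
by move=> x y xy Ax Ay; exact: f'c.
Qed.

End FiniteDegree.

(** * Edge chromatic numbers *)

Lemma polish_realType (R : realType) : polish R (R : topologicalType).
Proof.
split.
  exists (range (@ratr R)); last exact: dense_rat.
  exact: card_le_trans (card_image_le _ _) (countableP _).
exists (R^o : metricType R), id, id; split=> //; try by move=> x.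
move=> F FF cF; exists (lim F); exact: (@cauchy_cvg (R : completeType) F FF cF).
Qed.

(** Colors must lie in a Polish space, so they are placed in the real line, where any set of
    naturals is a countable union of closed points. *)
Lemma borel_edge_colorable_nat (R : realType) (X : topologicalType)
    (H : set (X * X)) (P : set nat) (c : X * X -> nat) (K : Type) :
  P #= [set: K] -> (forall p, H p -> P (c p)) ->
  (forall n, borel (H `&` [set p | c p = n])) ->
  (forall x y, H (x, y) -> c (x, y) = c (y, x)) ->
  (forall x y z, H (x, y) -> H (x, z) -> y <> z -> c (x, y) <> c (x, z)) ->
  borel_edge_colorable R H K.
Proof.
move=> PK HP bc sc pc.
have natr_inj : injective (fun n : nat => (n%:R : R)%R).
  by move=> m n /eqP; rewrite eqr_nat => /eqP.
exists (R : topologicalType), ((fun n : nat => (n%:R : R)%R) @` P),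
  (fun p => ((c p)%:R : R)%R); split.
- exact: polish_realType.
- have -> : (fun n : nat => (n%:R : R)%R) @` P =
      [set x | exists n, P n /\ x = (n%:R : R)%R].
    by apply/seteqP; split=> x => [[n Pn <-]|[n [Pn ->]]]; exists n.
  apply: borel_exists => n; apply: borel_and; first exact: borel_cst.
  apply: borel_closed; apply: accessible_closed_set1.
  exact: hausdorff_accessible (@Rhausdorff R).
- by apply: card_eq_trans PK; apply: inj_card_eq => m n _ _; exact: natr_inj.
- split=> [p Hp|x y Hxy|x y z xy xz yz|B _].
  + by exists (c p) => //; exact: HP.
  + by rewrite sc.
  + by move=> /natr_inj; exact: pc.
  + have -> : H `&` (fun p => ((c p)%:R : R)%R) @^-1` B =
        [set p | exists n, B (n%:R : R)%R /\ (H `&` [set p | c p = n]) p].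
      apply/seteqP; split=> p /= => [[Hp Bp]|[n [Bn [Hp cn]]]]; first by exists (c p).
      by split=> //; rewrite /preimage /= cn.
    by apply: borel_exists => n; apply: borel_and; [exact: borel_cst|exact: bc].
Qed.

Lemma borel_edge_colorable_card (R : realType) (X : topologicalType)
    (H : set (X * X)) (K L : Type) :
  [set: K] #= [set: L] -> borel_edge_colorable R H K -> borel_edge_colorable R H L.
Proof.
move=> KL [Y [S [c [pY bS SK hc]]]]; exists Y, S, c; split=> //.
exact: card_eq_trans SK KL.
Qed.

Lemma card_option (D : Type) n : [set: D] #= `I_n -> `I_n.+1 #<= [set: option D].
Proof.
move=> /card_set_bijP[h [hn _ hs]].
have -> : `I_n.+1 = (fun o => if o is Some x then h x else n) @` [set: option D].
  apply/seteqP; split=> k /=.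
    rewrite ltnS leq_eqVlt => /orP[/eqP->|/hs[x _ <-]]; first by exists None.
    by exists (Some x).
  by move=> [[x|] _ <-] //; apply: leqW; exact: (hn x).
exact: card_image_le.
Qed.

Lemma degree_le_card (X : topologicalType) (G : set (X * X)) n :
  (forall x, neighbors G x #<= `I_n) -> degree_le n G.
Proof.
move=> hn x s us sG.
rewrite -card_le_II; apply: card_le_trans (hn x).
have inj : {in `I_(size s) &, injective (nth x s)}.
  by move=> i j /set_mem /= si /set_mem /= sj /eqP; rewrite nth_uniq// => /eqP.
rewrite -(card_le_eql (inj_card_eq inj)); apply: subset_card_le.
by move=> _ [i si <-]; apply: sG; exact: mem_nth.
Qed.

Theorem theorem1p2 (R : realType) (X : ptopologicalType) (hX : polish R X)
    (mu : probability (g_sigma_algebraType (@open X)) R)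
    (G : set (X * X)) (hG : borel_graph G) (hbip : bipartite G)
    (hhyp : mu_hyperfinite mu G)
    (Delta : Type) (hDelta : is_max_degree G Delta) :
  exists2 K : Type, is_mu_edge_chromatic_number mu G K
    & [set: K] #<= [set: option Delta].
Proof.
pose Q n := exists2 C, conull_invariant_borel mu G C
  & borel_edge_colorable R (restrict G C) 'I_n.
have ordE n : [set: 'I_n] #= `I_n by rewrite card_eq_sym; exact: card_II.
have ord_le n (L : Type) : infinite_set [set: L] -> [set: 'I_n] #<= [set: L].
  move=> /infiniteP; apply: card_le_trans.
  by rewrite (card_le_eql (ordE n)); exact: card_leT.
have QL C (L : Type) : conull_invariant_borel mu G C ->
    borel_edge_colorable R (restrict G C) L -> finite_set [set: L] ->
    exists2 n, Q n & [set: L] #= [set: 'I_n].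
  move=> hC hL /finite_setP[n Ln].
  have LE : [set: L] #= [set: 'I_n] by apply: card_eq_trans Ln _; exact: card_II.
  by exists n => //; exists C => //; exact: borel_edge_colorable_card LE hL.
have Qfin n : [set: Delta] #= `I_n -> Q n.+1.
  move=> Dn; have nb x : neighbors G x #<= `I_n.
    by rewrite -(card_le_eqr Dn); exact: hDelta.1.
  have [|C [c [hC bc hc]]] := mu_hyperfinite_coloring hX hG hbip hhyp (degree_le_card nb).
    by move=> x; apply: card_le_finite (nb x) (finite_II n).
  have [cN cs cp] := hc; exists C => //.
  apply: (borel_edge_colorable_nat (c := c) R card_II) => //.
  - by move=> [x y]; exact: cN.
  - move=> k; apply: borel_and; last exact: bc.
    by apply: borel_restrict; [have [] := hG|have [] := hC].
  - by move=> x y z xy xz yz cE; apply: yz; exact: cp cE.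
have [exQ|nQ] := pselect (exists n, Q n).
  have exQ' : exists n, `[< Q n >] by have [n ?] := exQ; exists n; exact/asboolP.
  case: (ex_minnP exQ') => m /asboolP[C hC hm] mmin.
  (* Minimality of [m] over all conull sets bounds every Borel coloring, so [m] is also the exact
     chromatic number on the chosen [C]. *)
  have minL C' (L : Type) : conull_invariant_borel mu G C' ->
      borel_edge_colorable R (restrict G C') L -> [set: 'I_m] #<= [set: L].
    move=> hC' hL; have [fL|] := pselect (finite_set [set: L]); last exact: ord_le.
    have [k Qk LE] := QL C' L hC' hL fL.
    rewrite (card_le_eqr LE) (card_le_eql (ordE m)) (card_le_eqr (ordE k)) card_le_II.
    by apply: mmin; apply/asboolP.
  exists 'I_m.
    split; first by exists C => //; split=> // L; exact: minL.
    by move=> C' L hC' [hL _]; exact: minL hL.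
  have [/finite_setP[n Dn]|iD] := pselect (finite_set [set: Delta]).
    apply: card_le_trans (card_option Dn).
    rewrite (card_le_eql (ordE m)) card_le_II; apply: mmin; apply/asboolP.
    exact: Qfin.
  apply: ord_le; apply: contra_not iD => fo.
  by apply: card_le_finite fo; rewrite -card_ge_some; exact: card_leT.
(* A finite [Delta] would give some [Q n]. So [Delta] is infinite, every available color set is
   infinite, and [nat] is the minimum once it is attained. *)
have iD : infinite_set [set: Delta] by move=> /finite_setP[n /Qfin]; apply: contra_not nQ; exists n.+1.
have minL C' (L : Type) : conull_invariant_borel mu G C' ->
    borel_edge_colorable R (restrict G C') L -> [set: nat] #<= [set: L].
  move=> hC' hL; apply/infiniteP => fL; apply: nQ.
  by have [k Qk _] := QL C' L hC' hL fL; exists k.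
exists nat; last first.
  apply: (card_le_trans (B := [set: Delta])); first exact/infiniteP.
  by rewrite -card_ge_some; exact: card_leT.
split; last by move=> C' L hC' [hL _]; exact: minL hL.
have [C hC hypC] := hhyp; exists C => //; split; last by move=> L; exact: minL.
have [phi [bphi Gphi]] := hyperfinite_enumeration hX hypC.
have [hausX [V hV] _] := polish_regular_basis hX.
have [bG sG iG] := hG; have [bC _ _] := hC.
have [||x|c [bc cs cp]] := countable_borel_coloring hausX hV bphi Gphi.
- exact: borel_restrict.
- exact: symmetric_restrict.
- by move=> [/iG].
exact: (borel_edge_colorable_nat (P := [set: nat]) (c := c) R).
Qed.
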